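(* There are precisely eight $\mathbb{Z}[\sqrt2]$-PCFs of $\sqrt{2+\sqrt2}$ of type $(0,3)$. They are $$\begin{aligned}\sqrt{2+\sqrt2}&=[\overline{3-\sqrt2,\ 1+\sqrt2,\ 3-2\sqrt2}]\\&=[\overline{1+\sqrt2,\ -1-\sqrt2,\ 1}]\\&=[\overline{1+\sqrt2,\ -1+\sqrt2,\ -1}]\\&=[\overline{3+3\sqrt2,\ 1-\sqrt2,\ 1+2\sqrt2}]\\&=[\overline{57-39\sqrt2,\ 239+169\sqrt2,\ -73+52\sqrt2}]\\&=[\overline{-421+299\sqrt2,\ -239-169\sqrt2,\ -551+390\sqrt2}]\\&=[\overline{203+143\sqrt2,\ -239+169\sqrt2,\ -109-78\sqrt2}]\\&=[\overline{681+481\sqrt2,\ 239-169\sqrt2,\ 369+260\sqrt2}].\end{aligned}$$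
   Context: A $\mathbb{Z}[\sqrt2]$-PCF of type $(0,3)$ of a number $\beta$ is a periodic continued fraction $[\overline{a_1,a_2,a_3}]$, with $(a_1,a_2,a_3)\in\mathbb{Z}[\sqrt2]^3$, whose value is $\beta$. Here $[\overline{a_1,a_2,a_3}]$ is the infinite continued fraction with partial quotients $c_1,c_2,\ldots$ equal to $a_1,a_2,a_3,a_1,a_2,a_3,\ldots$. With $D(c)=\begin{bmatrix}c&1\\1&0\end{bmatrix}$, its $n$-th convergent is $M_{11}/M_{21}\in\mathbb{P}^1(\mathbb{C})$ where $M=D(c_1)\cdots D(c_n)$ (i.e. the usual finite continued fraction $[c_1,\ldots,c_n]$), and its value is the limit of the convergents in $\mathbb{P}^1(\mathbb{C})$, if it exists. *)

(* Defs.v *)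
From HB Require Import structures.
From mathcomp Require Import all_boot all_order all_algebra.
From mathcomp Require Import complex.
From mathcomp Require Import all_classical all_reals all_analysis.

Set Implicit Arguments.
Unset Strict Implicit.
Unset Printing Implicit Defensive.

Import Order.TTheory GRing.Theory Num.Theory.
Import numFieldNormedType.Exports.

Local Open Scope classical_set_scope.
Local Open Scope ring_scope.
Local Open Scope complex_scope.

Section ContinuedFractions.
Context {R : realType}.
Local Notation C := R[i].

(* The projective line P^1(C), as the Riemann sphere: [Some z] is the point
   [z : 1] and [None] is the point [1 : 0].  The alias [C^o] is what carries
   the topology of the complex modulus. *)
Definition P1 : topologicalType := one_point_compactification C^o.

(* The point [x : y], for (x, y) != (0, 0). *)
Definition P1_ratio (x y : C) : P1 := if y == 0 then None else Some (x / y).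

(* Entry (i, j) depends on i + j only: D(c) has rows (c, 1) and (1, 0). *)
Definition cf_step (c : C) : 'M[C]_2 :=
  \matrix_(i, j) [:: c; 1; 0]`_(i + j)%N.

(* Partial quotients are indexed from 0: [c k] is the (k+1)-st one. *)
Definition cf_matrix (c : nat -> C) (n : nat) : 'M[C]_2 :=
  \prod_(k < n) cf_step (c k).

Definition cf_convergent (c : nat -> C) (n : nat) : P1 :=
  P1_ratio (cf_matrix c n 0 0) (cf_matrix c n 1 0).

Definition cf_has_value (c : nat -> C) (z : P1) : Prop :=
  cf_convergent c n @[n --> \oo] --> z.

Definition periodic_quotients (m : nat) (a : m.-tuple C) (k : nat) : C := a`_(k %% m).

Definition triple (x y z : C) : 3.-tuple C := [tuple x; y; z].

Definition sqrt2 : C := (Num.sqrt (2 : R))%:C.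

Definition Zsqrt2 : set C :=
  [set x | exists u v : int, x = u%:~R + v%:~R * sqrt2].

(* PCFs of type (0, m): no preperiod, period length m > 0. *)
Definition Zsqrt2_PCF (m : nat) (beta : C) (a : m.-tuple C) : Prop :=
  (forall i, Zsqrt2 (tnth a i)) /\ cf_has_value (periodic_quotients a) (Some beta).

End ContinuedFractions.

(* Main.v *)
(* Write s for sqrt 2.  A triple (a1, a2, a3) has value beta = sqrt (2 + s) iff
   the matrix of its period fixes beta and beta is the attracting fixed point.
   Since beta is irrational over Q(s), fixing beta means that the matrix is
   (x, beta^2 y; y, x) with x = a2 and y = a2 a3 + 1; its determinant gives
   x^2 + 1 = (2 + s) y^2, and x (a1 - (2 + s) a3) = 1 + s makes x = U + V s a
   unit of Z[s].  The attracting condition is x y > 0.  Comparing norms,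
   U^2 - 2 V^2 = 1 is impossible, and U^2 - 2 V^2 = -1 forces |V| to be a
   perfect square d^2, so that U^2 + 1 = 2 d^4.

   Everything rests on Ljunggren's theorem: X^2 + 1 = 2 Y^4 only for Y = 1
   and Y = 13.  Parametrizing Pythagorean triples twice produces a Gaussian
   integer W with |W|^2 = Y such that (1 + i) W^4 has imaginary part 1 or -1,
   so that a conjugate quotient of W approximates a fourth root of
   v / u, where u = (1 + i) (3 + 2i)^4 = -239 + i and v is the conjugate of u.
   The Pade approximants of (1 - x)^(1/4) at x = 1 - v / u = 2i / u are
   Gaussian integers after multiplication by (4 u)^r, and they approximate the
   fourth root so well (Thue-Siegel) that |W| < 48 * 16^3.  The solutions below
   that bound are found among the first solutions of the Pell equation
   X^2 - 2 V^2 = -1, where residues modulo 21, 31, 13, 19 exclude that V is a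
   square. *)
Require Import Defs.
From HB Require Import structures.
From mathcomp Require Import all_boot all_order all_algebra.
From mathcomp Require Import complex realalg.
From mathcomp Require Import all_classical all_reals all_analysis.
From mathcomp Require Import finmap zify ring lra.

Set Implicit Arguments.
Unset Strict Implicit.
Unset Printing Implicit Defensive.

Import Order.TTheory GRing.Theory Num.Theory Normc.
Import numFieldNormedType.Exports.

Local Open Scope classical_set_scope.
Local Open Scope ring_scope.
Local Open Scope complex_scope.

(** * Pade approximants of the fourth root *)

(** Equations modulo a hypothesis [a = b] are reduced to ring identities: [c] is the cofactor of the
    hypothesis, and [ring] checks the certificate. *)
Lemma lincomb (S : comNzRingType) (c a b x y : S) :
  a = b -> x - y = c * (a - b) -> x = y.
Proof. by move=> -> /eqP; rewrite subrr mulr0 subr_eq0 => /eqP. Qed.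

Lemma lincomb2 (S : comNzRingType) (c d a b a1 b1 x y : S) :
  a = b -> a1 = b1 -> x - y = c * (a - b) + d * (a1 - b1) -> x = y.
Proof. by move=> -> -> /eqP; rewrite !subrr !mulr0 addr0 subr_eq0 => /eqP. Qed.

(** The generalized binomial coefficient a (a - 1) ... (a - k + 1) / k!. *)
Definition gbin {F : fieldType} (a : F) (k : nat) : F :=
  (\prod_(j < k) (a - j%:R)) / k`!%:R.

(* The [r/r] Pade approximant of (1 - x)^(1/4) is pade (1/4) r / pade (-1/4) r.
   This normalization clears all odd primes from the denominators. *)
Definition pade {F : fieldType} (s : F) (r : nat) : {poly F} :=
  \poly_(k < r.+1) ((-1) ^+ k * gbin (r%:R + s) k * 'C(2 * r - k, r)%:R).

Section PadeAlgebra.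
Context {R : realFieldType}.
Implicit Types (s : R) (A B p : {poly R}).

Lemma gbinS (a : R) k : k.+1%:R * gbin a k.+1 = (a - k%:R) * gbin a k.
Proof.
rewrite /gbin big_ord_recr /= factS natrM.
have h1 : (k.+1%:R : R) != 0 by rewrite pnatr_eq0.
have h2 : (k`!%:R : R) != 0 by rewrite pnatr_eq0 -lt0n fact_gt0.
by field; rewrite h2 /= addrC natr1 h1.
Qed.

Lemma gbin0 (a : R) : gbin a 0 = 1.
Proof. by rewrite /gbin big_ord0 fact0 divr1. Qed.

(** The ratio of consecutive hypergeometric coefficients, with denominators cleared so that it holds
    for every k: at k = r the factor r - k vanishes, and beyond r both coefficients do. *)
Lemma pade_rec s r k :
  k.+1%:R * (2 * r%:R - k%:R) * (pade s r)`_k.+1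
  = - ((r%:R + s - k%:R) * (r%:R - k%:R)) * (pade s r)`_k.
Proof.
rewrite !coef_poly ltnS (ltnS k r); case: (ltngtP k r) => [kr|rk|->]; last 2 first.
- by rewrite !mulr0.
- by rewrite subrr !(mulr0, mul0r) oppr0 mul0r.
have h : (2 * r%:R - k%:R) * 'C(2 * r - k.+1, r)%:R
       = (r%:R - k%:R) * 'C(2 * r - k, r)%:R :> R.
  have := mul_bin_down (2 * r - k) r.
  rewrite (_ : (2 * r - k).-1 = 2 * r - k.+1)%N; last by lia.
  move/(congr1 (fun n => n%:R : R)); rewrite !natrM !natrB ?natrM; try lia.
  by move=> ->; congr (_ * _); ring.
rewrite exprS.
transitivity (- ((-1) ^+ k * (k.+1%:R * gbin (r%:R + s) k.+1)
   * ((2 * r%:R - k%:R) * 'C(2 * r - k.+1, r)%:R)) : R); first by ring.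
by rewrite h gbinS; ring.
Qed.

(* Four times the hypergeometric operator with solution 2F1(-r - s, -r; -2r; x). *)
Definition hyper_op s r p : {poly R} :=
  4 * ('X * (1 - 'X)) * p^`()^`()
  - (8 * r%:R + (4 - 8 * r%:R - (4 * s)%:P) * 'X) * p^`()
  - r%:R * (4 * r%:R + (4 * s)%:P) * p.

Lemma coef_hyper_op s r p k : (hyper_op s r p)`_k =
  4 * (k.+1%:R * (k%:R - 2 * r%:R) * p`_k.+1
       - (k%:R - r%:R) * (k%:R - r%:R - s) * p`_k).
Proof.
have -> : hyper_op s r p
   = (4 : R)%:P * ('X * p^`()^`() - 'X * ('X * p^`()^`()))
   - (8 * r%:R : R)%:P * p^`() - (4 - 8 * r%:R - 4 * s : R)%:P * ('X * p^`())
   - (r%:R * (4 * r%:R + 4 * s) : R)%:P * p by rewrite /hyper_op /=; ring.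
rewrite !coefB !coefCM !coefB !coefXM !coef_deriv.
by case: k => [|[|k]] /=; rewrite ?coefXM ?coef_deriv /=; ring.
Qed.

Lemma hyper_op_pade s r : hyper_op s r (pade s r) = 0.
Proof.
apply/polyP => k; rewrite coef_hyper_op coef0.
apply: (lincomb (c:=-4) (pade_rec s r k)); ring.
Qed.

Lemma hyper_opB s r p q : hyper_op s r (p - q) = hyper_op s r p - hyper_op s r q.
Proof. by rewrite /hyper_op !derivB; ring. Qed.

Lemma size_pade s r : (size (pade s r) <= r.+1)%N.
Proof. exact: size_poly. Qed.

End PadeAlgebra.

Lemma coefM_top {F : nzRingType} (p q : {poly F}) m n :
  (size p <= m.+1)%N -> (size q <= n.+1)%N -> (p * q)`_(m + n) = p`_m * q`_n.
Proof.
move=> sp sq; rewrite coefM.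
have im : (m < (m + n).+1)%N by lia.
rewrite (bigD1 (Ordinal im)) //= addKn big1 ?addr0 // => i.
rewrite -val_eqE /= => ne; case: (ltngtP i m) => him.
- have -> : q`_(m + n - i) = 0.
    by apply: nth_default; apply: leq_trans sq _; rewrite ltn_subRL addnC; lia.
  by rewrite mulr0.
- have -> : p`_i = 0 by apply: nth_default; apply: leq_trans sp him.
  by rewrite mul0r.
- by rewrite him eqxx in ne.
Qed.

Lemma leq_size_deriv {F : nzSemiRingType} (p : {poly F}) n :
  (size p <= n.+1)%N -> (size p^`() <= n)%N.
Proof.
move=> sp; apply/leq_sizeP => j nj; rewrite coef_deriv nth_default ?mul0rn //.
exact: (leq_trans sp (_ : n.+1 <= j.+1)%N).
Qed.

Section PadeWronskian.
Context {R : realFieldType}.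
Implicit Types (s : R) (A B p : {poly R}).

Local Notation padeA r := (pade (4%:R^-1 : R) r).
Local Notation padeB r := (pade (- 4%:R^-1 : R) r).

Definition pade_const r : R := (padeA r)`_r * (padeB r)`_r.

Lemma four_inv4 : 4 * 4%:R^-1 = 1 :> R.
Proof. by rewrite divff // pnatr_eq0. Qed.

(* By the two differential equations the left-hand side N satisfies
   x N' = 2 r N, so it is a monomial of degree 2 r. *)
Lemma pade_wronskian r :
  let A := padeA r in let B := padeB r in
  4 * (1 - 'X) * (A^`() * B - A * B^`()) + A * B = (pade_const r)%:P * 'X^(2 * r).
Proof.
move=> A B; set N := LHS.
have hA : hyper_op 4%:R^-1 r A = 0 by exact: hyper_op_pade.
have hB : hyper_op (- 4%:R^-1) r B = 0 by exact: hyper_op_pade.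
rewrite /hyper_op ?mulrN four_inv4 ?polyCN in hA hB.
(* The second derivatives in x N' are removed by B times the equation of A minus A times the
   equation of B. *)
have hN : 'X * N^`() = (2 * r%:R) * N.
  rewrite /N !poly.derivE.
  apply: (lincomb2 (c:=B) (d:=-A) hA hB); ring.
have sA : (size A <= r.+1)%N := size_pade _ r.
have sB : (size B <= r.+1)%N := size_pade _ r.
(* Only A B contributes in degree 2 r: the polynomial A' B - A B' has degree at most 2 r - 1, and
   there the two products of leading coefficients cancel. *)
have top : N`_(2 * r) = pade_const r.
  have eN : N = (4 : R)%:P * (A^`() * B - A * B^`())
     - (4 : R)%:P * ('X * (A^`() * B - A * B^`())) + A * B.
    by rewrite /N /=; ring.
  rewrite eN !coefD coefN !coefCM coefXM coefB mul2n -addnn (coefM_top sA sB).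
  have -> : pade_const r = A`_r * B`_r by [].
  clear -sA sB; case: r A B sA sB => [|r] A B sA sB /=.
    have szd p : (size p <= 1)%N -> p^`() = 0.
      by move=> h; apply/eqP; rewrite -size_poly_eq0 -leqn0 leq_size_deriv.
    by rewrite !szd // mul0r mulr0 !coef0 subrr !mulr0 subr0 add0r.
  have sA' := leq_size_deriv sA; have sB' := leq_size_deriv sB.
  rewrite !coefB (coefM_top (leqW sA') sB) (coefM_top sA (leqW sB')).
  rewrite (nth_default 0 sA') (nth_default 0 sB') (coefM_top sA' sB).
  rewrite -addSnnS (coefM_top sA sB') !coef_deriv.
  ring.
apply/polyP => k; rewrite coefCM coefXn.
have /(congr1 (fun p : {poly R} => p`_k)) := hN.
have -> : 2 * r%:R * N = (2 * r%:R : R)%:P * N by rewrite /=; ring.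
rewrite coefCM coefXM coef_deriv; case: (eqVneq k (2 * r)%N) => [->|ne].
  by rewrite top mulr1.
case: k ne => [|k] ne /=; rewrite mulr0 => h.
  have {}h : 2 * r%:R * N`_0 = 0 := esym h.
  move/eqP: h; rewrite mulf_eq0 -natrM pnatr_eq0 => /orP[|/eqP//].
  by move=> h; rewrite eq_sym h in ne.
have : (k.+1%:R - 2 * r%:R) * N`_k.+1 = 0 by rewrite mulrBl -h mulr_natl subrr.
by move/eqP; rewrite mulf_eq0 -natrM subr_eq0 eqr_nat (negPf ne) => /eqP.
Qed.
End PadeWronskian.

Lemma drop_poly_dvd {F : nzRingType} (p : {poly F}) m :
  (forall k, (k < m)%N -> p`_k = 0) -> p = drop_poly m p * 'X^m.
Proof.
move=> h; rewrite -{1}[p](poly_take_drop m); suff -> : take_poly m p = 0 by rewrite add0r.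
by apply/polyP => k; rewrite coef_take_poly coef0; case: ifP => // /h.
Qed.

(** * The remainder of the Pade approximation *)

Section PadeRemainder.
Context {R : realFieldType}.
Implicit Types (s : R) (A B p : {poly R}).

Local Notation padeA r := (pade (4%:R^-1 : R) r).
Local Notation padeB r := (pade (- 4%:R^-1 : R) r).

(** The Taylor polynomial of (1 - x)^(1/4). Working with truncations keeps the argument inside
    polynomials; the order n is taken large at the end. *)
Definition root4_trunc n : {poly R} :=
  \poly_(k < n.+1) ((-1) ^+ k * gbin (4%:R^-1) k).

Definition pade_rem n r : {poly R} := padeA r - root4_trunc n * padeB r.

Lemma coef_root4_trunc n k : (k <= n)%N ->
  (root4_trunc n)`_k = (-1) ^+ k * gbin (4%:R^-1) k.
Proof. by rewrite coef_poly ltnS => ->. Qed.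

(** The function (1 - x)^(1/4) satisfies 4 (1 - x) f' + f = 0; truncation leaves a single term of
    degree n. *)
Lemma root4_trunc_ode n : let f := root4_trunc n in
  4 * (1 - 'X) * f^`() + f = ((1 - 4 * n%:R) * f`_n)%:P * 'X^n.
Proof.
move=> f; have -> : 4 * (1 - 'X) * f^`() + f =
  (4 : R)%:P * f^`() - (4 : R)%:P * ('X * f^`()) + f by rewrite /=; ring.
apply/polyP => k; rewrite coefD coefB !coefCM coefXM !coef_deriv coefXn.
have -> : (if k == 0 then 0 else f`_k.-1.+1 *+ k.-1.+1) = k%:R * f`_k.
  by case: k => [|k] /=; rewrite ?mul0r // mulr_natl.
case: (ltngtP k n) => [kn|nk|->].
- rewrite /f !coef_root4_trunc // ?(ltnW kn) // mulr0 exprS.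
  have := @gbinS R 4%:R^-1 k => h.
  apply: (lincomb (c:=- 4 * (-1) ^+ k) h); have := @four_inv4 R => h4.
  apply: (lincomb (c:= - (-1) ^+ k * gbin 4%:R^-1 k) h4); ring.
- have sf : (size f <= k)%N by exact: leq_trans (size_poly _ _) nk.
  have -> : f`_k = 0 by exact: nth_default.
  have -> : f`_k.+1 = 0 by apply: nth_default; exact: leqW.
  by rewrite !mulr0 mul0rn; ring.
- rewrite [f`_(n.+1)]coef_poly ltnn mulr1; ring.
Qed.

(** Euler's transformation of 2F1: (1 - x)^(1/4) times the denominator B solves the hypergeometric
    equation of the numerator A. The truncation costs an error divisible by x^n. *)
Lemma hyper_op_root4M n r : let f := root4_trunc n in let B := padeB r in
  let e := ((1 - 4 * n%:R) * f`_n) in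
  hyper_op 4%:R^-1 r (f * B) =
    'X^n * (e%:P * ((n%:R - 2 * r%:R) * B + 2 * 'X * B^`())).
Proof.
move=> f B e.
have hf : 4 * (1 - 'X) * f^`() + f = e%:P * 'X^n := root4_trunc_ode n.
have hf' : 4 * (1 - 'X) * f^`()^`() = 3 * f^`() + e%:P * ('X^n)^`().
  have := congr1 deriv hf; rewrite !poly.derivE => h; apply: (lincomb (c:=1) h); ring.
have hX : 'X * ('X^n)^`() = n%:R * 'X^n :> {poly R}.
  rewrite derivXn; case: n {f e hf hf'} => [|n]; first by rewrite mulr0n mul0r mulr0.
  by rewrite exprS mulrnAr mulr_natl.
have hB : hyper_op (- 4%:R^-1) r B = 0 by exact: hyper_op_pade.
rewrite /hyper_op ?mulrN four_inv4 ?polyCN in hB *.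
rewrite !poly.derivE.
apply: (lincomb2 (c:='X * B) (d := f) hf' hB).
apply: (lincomb2 (c:=2 * 'X * B^`() - 2 * r%:R * B) (d := e%:P * B) hf hX); ring.
Qed.

(** Below degree n the remainder satisfies the same differential equation as A, hence the same
    two-term recurrence. *)
Lemma pade_rem_rec n r k : (k < n)%N ->
  k.+1%:R * (k%:R - 2 * r%:R) * (pade_rem n r)`_k.+1 =
  (k%:R - r%:R) * (k%:R - r%:R - 4%:R^-1) * (pade_rem n r)`_k.
Proof.
move=> kn; have h : (hyper_op 4%:R^-1 r (pade_rem n r))`_k = 0.
  by rewrite hyper_opB hyper_op_pade sub0r hyper_op_root4M coefN coefXnM kn oppr0.
move: h; rewrite coef_hyper_op => /eqP; rewrite mulf_eq0 pnatr_eq0 /= subr_eq0.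
by move/eqP.
Qed.

Lemma coef0_pade s r : (pade s r)`_0 = 'C(2 * r, r)%:R.
Proof. by rewrite coef_poly /= gbin0 subn0 !mul1r. Qed.

(** The constant term vanishes, and the recurrence propagates this until its factor k - 2 r becomes
    zero, that is, through index 2 r. *)
Lemma pade_rem_low n r k : (k <= 2 * r)%N -> (k <= n)%N -> (pade_rem n r)`_k = 0.
Proof.
elim: k => [|k IH] kr kn.
  rewrite coefB coef0M !coef0_pade coef_root4_trunc // gbin0; ring.
have := pade_rem_rec r kn; rewrite IH ?mulr0; [|exact: ltnW|exact: ltnW].
move/eqP; rewrite !mulf_eq0 pnatr_eq0 /= -natrM subr_eq0 eqr_nat.
by rewrite ltn_eqF // => /eqP.
Qed.

(** Substituting A = P + f B into the Wronskian identity and using the equation of f leaves an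
    identity in P and B, whose lowest coefficient is the one wanted. *)
Lemma pade_rem_lead n r : (2 * r < n)%N ->
  4 * (2 * r).+1%:R * 'C(2 * r, r)%:R * (pade_rem n r)`_(2 * r).+1 = pade_const r.
Proof.
move=> rn; set P := pade_rem n r; set B := padeB r; set f := root4_trunc n.
have eP : P = drop_poly (2 * r).+1 P * 'X^((2 * r).+1).
  by apply: drop_poly_dvd => k kr; apply: pade_rem_low; lia.
set S := drop_poly _ P in eP.
have S0 : S`_0 = P`_(2 * r).+1 by rewrite /S coef_drop_poly.
set A := padeA r.
have hN : 4 * (1 - 'X) * (A^`() * B - A * B^`()) + A * B =
  (pade_const r)%:P * 'X^(2 * r) := pade_wronskian r.
set e := ((1 - 4 * n%:R) * f`_n)%:P.
have hf : 4 * (1 - 'X) * f^`() + f = e * 'X^n := root4_trunc_ode n.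
have eA : A = P + f * B by rewrite /P /pade_rem subrK.
have B0 : B`_0 = 'C(2 * r, r)%:R by exact: coef0_pade.
clearbody e f A B S P.
have : 4 * (1 - 'X) * (P^`() * B - P * B^`()) + P * B
     = (pade_const r)%:P * 'X^(2 * r) - e * 'X^n * B ^+ 2.
  move: hN; rewrite eA !poly.derivE => hN.
  apply: (lincomb2 (c:=1) (d:=-B^+2) hN hf) ; ring.
move=> h; rewrite eP !poly.derivE /= in h.
(* Both sides are multiples of x^(2 r); the claim compares their coefficients in that degree. *)
have {}h : 'X^(2 * r) * ((4 * (2 * r).+1%:R : R)%:P * (S * B) + 'X *
   (4 * (1 - 'X) * (S^`() * B - S * B^`()) + S * B - 4 * (2 * r).+1%:R * (S * B)))
  = 'X^(2 * r) * ((pade_const r)%:P - e * 'X^((n - (2 * r).+1)) * 'X * B ^+ 2).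
  have -> : 'X^(2 * r) * ((pade_const r)%:P - e * 'X^((n - (2 * r).+1)) * 'X * B ^+ 2)
    = (pade_const r)%:P * 'X^(2 * r) - e * 'X^n * B ^+ 2.
    rewrite -{2}(subnK rn) exprD (exprS 'X); ring.
  rewrite -h (exprS 'X); ring.
have {h} := congr1 (fun p : {poly R} => p`_(2 * r + 0)) h.
rewrite !coefXnM ltnNge leq_addr /= addKn coefD coefCM coef0M coefXM /= addr0.
rewrite coefB coefC /= -mulrA [in X in _ - X]mulrC -!mulrA coefXM /= subr0 => <-.
by rewrite S0 B0; ring.
Qed.

(** At k = 2 r + 1 + j the recurrence has ratio (r + j + 1) (r + j + 3/4) / ((k + 1) (j + 1)), which
    is at most (r + j + 1) / (j + 1), the ratio of consecutive binomials C(r + j, j). *)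
Lemma pade_rem_coef_le n r j : ((2 * r).+1 + j <= n)%N ->
  `|(pade_rem n r)`_((2 * r).+1 + j)| <= 'C(r + j, j)%:R * `|(pade_rem n r)`_(2 * r).+1|.
Proof.
elim: j => [|j IH] jn; first by rewrite addn0 bin0 mul1r.
rewrite addnS in jn *.
have := pade_rem_rec r jn; set k := ((2 * r).+1 + j)%N.
move/(congr1 Num.norm); rewrite !normrM.
rewrite normr_nat.
have ek : k%:R = 2 * r%:R + 1 + j%:R :> R by rewrite /k natrD -natr1 natrM.
have -> : k%:R - 2 * r%:R = j.+1%:R :> R by rewrite ek -[j.+1%:R]natr1; ring.
have -> : k%:R - r%:R = (r + j).+1%:R :> R by rewrite ek -[(r + j).+1%:R]natr1 natrD; ring.
rewrite !normr_nat => h.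
have h1 : `|(r + j).+1%:R - 4%:R^-1| <= k.+1%:R :> R.
  have h4 := @four_inv4 R; set q := 4%:R^-1 in h4 *.
  have hk : (r + j).+1%:R <= k.+1%:R :> R by rewrite ler_nat /k; lia.
  have h0 : 1 <= (r + j).+1%:R :> R by rewrite ler1n.
  by rewrite ger0_norm; lra.
have hb : j.+1%:R * 'C((r + j).+1, j.+1)%:R = (r + j).+1%:R * 'C(r + j, j)%:R :> R.
  by rewrite -!natrM mul_bin_diag.
have k0 : 0 < k.+1%:R :> R by rewrite ltr0n.
have j0 : 0 < j.+1%:R :> R by rewrite ltr0n.
have {}IH := IH (ltnW jn).
rewrite -(ler_pM2l (mulr_gt0 k0 j0)) h.
rewrite [(r + j.+1)%N]addnS; set L := `|(pade_rem n r)`_((2 * r).+1)| in IH *.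
set C := 'C(r + j, j)%:R in hb IH *.
have -> : k.+1%:R * j.+1%:R * ('C((r + j).+1, j.+1)%:R * L)
  = (r + j).+1%:R * (k.+1%:R * (C * L)) :> R.
  by rewrite -mulrA [j.+1%:R * _]mulrA hb; ring.
by rewrite -mulrA ler_wpM2l ?ler0n //; apply: ler_pM.
Qed.
End PadeRemainder.

Lemma bin_le_exp2 n k : ('C(n, k) <= 2 ^ n)%N.
Proof.
elim: n k => [|n IH] [|k] //; first by rewrite bin0 expn_gt0.
by rewrite binS expnS mul2n -addnn leq_add.
Qed.

Lemma central_bin_ge r : (4 ^ r <= (2 * r).+1 * 'C(2 * r, r))%N.
Proof.
elim: r => [//|r IH].
have h1 := mul_bin_diag (2 * r).+2 r; have h2 := mul_bin_down (2 * r).+1 r.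
have -> : (2 * r.+1 = (2 * r).+2)%N by lia.
rewrite /= in h1 h2; rewrite expnS.
have : (r.+1 * (4 * 4 ^ r) <= r.+1 * ((2 * r).+3 * 'C((2 * r).+2, r.+1)))%N by nia.
by rewrite leq_pmul2l.
Qed.

(** Lowering 2 r - k by one multiplies the binomial by (r - k) / (2 r - k), which is at most 1/2.
    This yields the factor 1 + y / 2 in the majorant of B. *)
Lemma bin_halving r k : (k <= r)%N -> (2 ^ k * 'C(2 * r - k, r) <= 'C(2 * r, r))%N.
Proof.
elim: k => [_|k IH kr]; first by rewrite mul1n subn0.
apply: leq_trans (IH (ltnW kr)); rewrite expnSr -mulnA leq_mul2l; apply/orP; right.
have := mul_bin_down (2 * r - k) r.
have -> : ((2 * r - k).-1 = 2 * r - k.+1)%N by lia.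
set m := (2 * r - k)%N => h; have m0 : (0 < m)%N by rewrite /m; lia.
have m1 : (2 * (m - r) <= m)%N by rewrite /m; lia.
by rewrite -(leq_pmul2l m0); nia.
Qed.

Lemma leq_size_polyM {F : nzRingType} (p q : {poly F}) m n :
  (size p <= m.+1)%N -> (size q <= n.+1)%N -> (size (p * q)%R <= (m + n).+1)%N.
Proof.
move=> sp sq; apply: leq_trans (size_polyMleq _ _) _.
by have := leq_add sp sq; move: (size p) (size q) => a b; lia.
Qed.

(** * Sizes and leading coefficients of the approximants *)

Section PadeCoefficients.
Context {R : realFieldType}.
Implicit Types (p q : {poly R}).

Local Notation padeA r := (pade (4%:R^-1 : R) r).
Local Notation padeB r := (pade (- 4%:R^-1 : R) r).

Lemma gbinSS (a : R) k : k.+1%:R * gbin (a + 1) k.+1 = (a + 1) * gbin a k.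
Proof.
rewrite /gbin big_ord_recl /= factS natrM subr0.
have -> : \prod_(i < k) (a + 1 - (bump 0 i)%:R) = \prod_(j < k) (a - j%:R).
  by apply: eq_bigr => i _; rewrite /bump add1n -natr1; ring.
have h1 : (k.+1%:R : R) != 0 by rewrite pnatr_eq0.
have h2 : (k`!%:R : R) != 0 by rewrite pnatr_eq0 -lt0n fact_gt0.
by field; rewrite h2 addrC natr1 h1.
Qed.

Lemma gbin_gt0 (a : R) k : k%:R - 1 < a -> 0 < gbin a k.
Proof.
move=> ka; rewrite divr_gt0 ?ltr0n ?fact_gt0 // prodr_gt0 // => i _.
have : i.+1%:R <= k%:R :> R by rewrite ler_nat.
by rewrite -natr1; lra.
Qed.

Lemma gbin_le_bin (a : R) (r k : nat) : (k <= r)%N -> r%:R - 1 < a -> a <= r%:R ->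
  gbin a k <= 'C(r, k)%:R.
Proof.
move=> kr ra ar; elim: k kr => [|k IH] kr; first by rewrite gbin0 bin0.
have k0 : 0 < k.+1%:R :> R by rewrite ltr0n.
rewrite -(ler_pM2l k0) gbinS -natrM mul_bin_left natrM natrB ?(ltnW kr) //.
have kr' : k.+1%:R <= r%:R :> R by rewrite ler_nat.
rewrite -natr1 in kr'; apply: ler_pM; rewrite ?IH ?(ltnW kr) //; try lra.
by rewrite ltW // gbin_gt0 //; lra.
Qed.

Lemma coef_top_pade (s : R) r : (pade s r)`_r = (-1) ^+ r * gbin (r%:R + s) r.
Proof. by rewrite coef_poly ltnSn mul2n -addnn addnK binn mulr1. Qed.

Lemma pade_const_eq r :
  pade_const r = gbin (r%:R + 4%:R^-1) r * gbin (r%:R - 4%:R^-1) r :> R.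
Proof.
rewrite /pade_const !coef_top_pade mulrACA -exprD addnn -mul2n exprM sqrrN.
by rewrite expr1n expr1n mul1r.
Qed.

Lemma pade_const_gt0 r : 0 < pade_const r :> R.
Proof.
have h4 := @four_inv4 R.
by rewrite pade_const_eq mulr_gt0 // gbin_gt0 //; lra.
Qed.

(** Passing from r to r + 1 multiplies the constant by 1 - (1 / (4 (r + 1)))^2. *)
Lemma pade_const_le1 r : pade_const r <= 1 :> R.
Proof.
rewrite pade_const_eq; elim: r => [|r IH]; first by rewrite !gbin0 mulr1.
have h4 := @four_inv4 R; set q := 4%:R^-1 in h4 IH *.
have := gbinSS (r%:R + q) r; have := gbinSS (r%:R - q) r.
rewrite (_ : r%:R - q + 1 = r.+1%:R - q); last by rewrite -natr1; ring.
rewrite (_ : r%:R + q + 1 = r.+1%:R + q); last by rewrite -natr1; ring.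
set x := gbin (r%:R + q) r in IH *; set y := gbin (r%:R - q) r in IH *.
set x' := gbin _ _ ; set y' := gbin _ _ => hx hy.
have k0 : 0 < r.+1%:R :> R by rewrite ltr0n.
have hp : 0 < x * y by rewrite -pade_const_eq pade_const_gt0.
rewrite -(ler_pM2l (mulr_gt0 k0 k0)) mulr1.
have -> : r.+1%:R * r.+1%:R * (y' * x') = (r.+1%:R ^+ 2 - q ^+ 2) * (x * y).
  by rewrite mulrACA hy hx; ring.
have : 0 < q ^+ 2 by rewrite exprn_gt0 //; lra.
by have := mulr_gt0 k0 k0; nra.
Qed.

Lemma coef_padeB_le r k :
  `|(padeB r)`_k| <= 'C(2 * r, r)%:R * ('C(r, k)%:R / 2 ^+ k).
Proof.
rewrite coef_poly ltnS; case: leqP => kr; last first.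
  by rewrite normr0 !mulr_ge0 ?invr_ge0 ?exprn_ge0 ?ler0n.
have h4 := @four_inv4 R; set q := 4%:R^-1 in h4 *.
have g0 : 0 < gbin (r%:R - q) k.
  have : k%:R <= r%:R :> R by rewrite ler_nat.
  by move=> ?; apply: gbin_gt0; lra.
have g1 : gbin (r%:R - q) k <= 'C(r, k)%:R by apply: gbin_le_bin => //; lra.
move: (gbin _ k) g0 g1 => g g0 g1.
rewrite !normrM normrX normrN normr1 expr1n mul1r normr_nat gtr0_norm //.
rewrite mulrA ler_pdivlMr ?exprn_gt0 // -mulrA [leRHS]mulrC.
apply: ler_pM; rewrite ?(ltW g0) ?mulr_ge0 ?exprn_ge0 ?ler0n //.
by rewrite -natrX -natrM ler_nat mulnC bin_halving.
Qed.

(** Eliminating f from the two remainders shows that the determinant has order at least 2 r + 1 at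
    0, and its degree is at most 2 r + 1. Hence two consecutive approximants never agree away from
    0. *)
Lemma pade_det r : exists2 d : R, d != 0 &
  padeA r * padeB r.+1 - padeA r.+1 * padeB r = d%:P * 'X^((2 * r).+1).
Proof.
set D := padeA r * padeB r.+1 - padeA r.+1 * padeB r.
exists D`_((2 * r).+1); last first.
  apply/polyP => k; rewrite coefCM coefXn; case: (ltngtP k (2 * r).+1) => [kr|kr|->].
  - rewrite mulr0; set n := (2 * r).+2.
    have -> : D = pade_rem n r * padeB r.+1 - pade_rem n r.+1 * padeB r.
      by rewrite /D /pade_rem; ring.
    rewrite coefB !coefM !big1 ?subr0 // => i _; rewrite pade_rem_low ?mul0r //;
      have := ltn_ord i; rewrite /n; lia.
  - rewrite mulr0 nth_default //.
    apply: leq_trans (size_polyD _ _) _; rewrite size_polyN geq_max.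
    have e : ((2 * r).+2 = (r + r.+1).+1)%N by lia.
    rewrite (leq_trans (leq_size_polyM (size_pade _ r) (size_pade _ r.+1))) -?e //.
    by rewrite (leq_trans (leq_size_polyM (size_pade _ r.+1) (size_pade _ r))) // addnC -e.
  - by rewrite mulr1.
have -> : (2 * r).+1 = (r + r.+1)%N by lia.
rewrite coefB coefM_top ?size_pade //.
rewrite [in X in _ - X](_ : r + r.+1 = r.+1 + r)%N; last by rewrite addnC.
rewrite (coefM_top (size_pade _ _) (size_pade _ _)) !coef_top_pade.
have h4 := @four_inv4 R; set q := 4%:R^-1 in h4 *.
have := gbinSS (r%:R + q) r; have := gbinSS (r%:R - q) r.
rewrite (_ : r%:R - q + 1 = r.+1%:R - q); last by rewrite -natr1; ring.
rewrite (_ : r%:R + q + 1 = r.+1%:R + q); last by rewrite -natr1; ring.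
have x0 : 0 < gbin (r%:R + q) r by apply: gbin_gt0; lra.
have y0 : 0 < gbin (r%:R - q) r by apply: gbin_gt0; lra.
move: (gbin (r%:R + q) r) (gbin (r%:R - q) r) x0 y0 => x y x0 y0.
move: (gbin (r.+1%:R + q) r.+1) (gbin (r.+1%:R - q) r.+1) => x' y' hy hx.
have k0 : r.+1%:R != 0 :> R by rewrite pnatr_eq0.
have : (-1) ^+ r != 0 :> R by rewrite expf_neq0 // oppr_eq0 oner_eq0.
rewrite exprS mulN1r; move: ((-1) ^+ r) => w w0.
have -> : w * x * (- w * y') - - w * x' * (w * y) = w ^+ 2 * (x' * y - x * y') by ring.
rewrite mulf_neq0 ?expf_neq0 //.
rewrite -(mulrI_eq0 _ (lregP k0)).
(* The top coefficients differ because r + 1 + q and r + 1 - q do, with q = 1/4. *)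
have -> : r.+1%:R * (x' * y - x * y') = 2 * q * (x * y).
  by rewrite mulrBr mulrA hx mulrCA hy; ring.
by rewrite !mulf_neq0 ?gt_eqF //; lra.
Qed.
End PadeCoefficients.

Definition absp {R : numDomainType} (p : {poly R}) : {poly R} :=
  \poly_(i < size p) `|p`_i|.

(** * Majorants by absolute values of coefficients *)

Section Majorants.
Context {R : realFieldType}.
Implicit Types (p q : {poly R}) (y : R).

Lemma coef_absp p i : (absp p)`_i = `|p`_i|.
Proof. by rewrite coef_poly; case: ltnP => // h; rewrite nth_default // normr0. Qed.

Lemma horner_ge0 p y : (forall i, 0 <= p`_i) -> 0 <= y -> 0 <= p.[y].
Proof.
by move=> p0 y0; rewrite horner_coef sumr_ge0 // => i _; rewrite mulr_ge0 ?exprn_ge0.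
Qed.

Lemma horner_le p q y : (forall i, p`_i <= q`_i) -> 0 <= y -> p.[y] <= q.[y].
Proof.
move=> pq y0; rewrite -subr_ge0 -hornerN -hornerD horner_ge0 // => i.
by rewrite coefD coefN subr_ge0.
Qed.

Lemma abspM_le p q y : 0 <= y -> (absp (p * q)).[y] <= (absp p).[y] * (absp q).[y].
Proof.
move=> y0; rewrite -hornerM horner_le // => k; rewrite coef_absp !coefM.
rewrite (le_trans (ler_norm_sum _ _ _)) // ler_sum // => i _.
by rewrite normrM !coef_absp.
Qed.

(** Every monomial present has degree at least m, so halving the argument gains 2^m. This turns a
    crude bound at 2 y into a small tail at y. *)
Lemma absp_shrink p y m : (forall k, (k < m)%N -> p`_k = 0) -> 0 <= y ->
  (absp p).[y] <= (absp p).[2 * y] / 2 ^+ m.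
Proof.
move=> pm y0; rewrite !horner_coef mulr_suml ler_sum // => i _.
rewrite coef_absp; case: (ltnP i m) => [/pm ->|mi]; first by rewrite normr0 !mul0r.
rewrite -mulrA ler_wpM2l // exprMn mulrAC ler_peMl ?exprn_ge0 //.
by rewrite ler_pdivlMr ?exprn_gt0 // mul1r ler_eXn2l // ltr1n.
Qed.

(** Partial sums of the series of (1 - y)^(-r-2): multiplication by 1 - y lowers the exponent by
    one, up to a boundary term that is nonpositive for y >= 0. *)
Lemma sum_neg_binomial r m y :
  (1 - y) * (\sum_(j < m) 'C(r.+1 + j, j)%:R * y ^+ j) =
  \sum_(j < m) 'C(r + j, j)%:R * y ^+ j - 'C(r + m, r.+1)%:R * y ^+ m.
Proof.
elim: m => [|m IH]; first by rewrite !big_ord0 addn0 bin_small // mulr0 mul0r subrr.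
rewrite !big_ord_recr /= mulrDr IH exprS.
have -> : 'C(r.+1 + m, m) = ('C(r + m, r.+1) + 'C(r + m, r))%N.
  by rewrite -bin_sub ?leq_addl // addnK addSn binS.
have -> : 'C(r + m.+1, r.+1) = ('C(r + m, r.+1) + 'C(r + m, r))%N.
  by rewrite addnS binS.
have -> : 'C(r + m, m) = 'C(r + m, r) by rewrite -bin_sub ?leq_addl // addnK.
by rewrite natrD; ring.
Qed.

Lemma sum_neg_binomial_le r m y : 0 <= y < 1 ->
  \sum_(j < m) 'C(r + j, j)%:R * y ^+ j <= ((1 - y) ^+ r.+1)^-1.
Proof.
move=> /andP[y0 y1]; have z0 : 0 < 1 - y by lra.
elim: r => [|r IH].
  rewrite expr1 -[leRHS]mul1r ler_pdivlMr // mulrC.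
  rewrite (eq_bigr (fun j : 'I_m => y ^+ j)); last first.
    by move=> j _; rewrite add0n binn mul1r.
  have := subrX1 y m; rewrite /= => h.
  have -> : (1 - y) * (\sum_(j < m) y ^+ j) = 1 - y ^+ m.
    by rewrite -(opprB (y ^+ m)) h; ring.
  by rewrite gerBl exprn_ge0.
rewrite exprS invfM -ler_pdivrMl ?invr_gt0 // invrK sum_neg_binomial.
by apply: le_trans IH; rewrite gerBl mulr_ge0 ?exprn_ge0.
Qed.

Local Notation padeB r := (pade (- 4%:R^-1 : R) r).

Lemma absp_padeB_le r y : 0 <= y -> (absp (padeB r)).[y] <= 4 ^+ r * (1 + y / 2) ^+ r.
Proof.
move=> y0; have sB : (size (absp (padeB r)) <= r.+1)%N.
  by rewrite (leq_trans (size_poly _ _)) // size_pade.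
rewrite (horner_coef_wide _ sB).
have c4 : 'C(2 * r, r)%:R <= 4 ^+ r :> R.
  by rewrite -natrX ler_nat (leq_trans (bin_le_exp2 _ _)) // expnM.
have y2 : 0 <= 1 + y / 2 by lra.
apply: (@le_trans _ _ ('C(2 * r, r)%:R * (1 + y / 2) ^+ r)); last first.
  by rewrite ler_wpM2r // exprn_ge0.
rewrite exprDn mulr_sumr ler_sum // => i _.
rewrite coef_absp expr1n mul1r -[_ ^+ i *+ _]mulr_natl.
apply: (@le_trans _ _ ('C(2 * r, r)%:R * ('C(r, i)%:R / 2 ^+ i) * y ^+ i)).
  by apply: ler_wpM2r; [exact: exprn_ge0 | exact: coef_padeB_le].
by rewrite exprMn exprVn le_eqVlt; apply/orP; left; apply/eqP; ring.
Qed.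

Lemma coef_root4_trunc_le n k : `|(root4_trunc n : {poly R})`_k| <= 1.
Proof.
rewrite coef_poly; case: ifP => _; last by rewrite normr0 ler01.
rewrite normrM normrX normrN normr1 expr1n mul1r.
elim: k => [|k IH]; first by rewrite gbin0 normr1.
have k0 : 0 < k.+1%:R :> R by rewrite ltr0n.
rewrite -(ler_pM2l k0) -{1}(gtr0_norm k0) -normrM gbinS normrM.
have h4 := @four_inv4 R; set q := 4%:R^-1 in h4 IH *.
have hk : 0 <= k%:R :> R by rewrite ler0n.
apply: ler_pM => //; rewrite -natr1 ler_norml; apply/andP; split; lra.
Qed.

Lemma absp_root4_trunc_le n y : 0 <= y <= 2^-1 -> (absp (root4_trunc n)).[y] <= 2.
Proof.
move=> /andP[y0 y1]; rewrite horner_coef.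
have := @sum_neg_binomial_le 0 (size (absp (root4_trunc n : {poly R}))) y.
rewrite expr1 => h; apply: le_trans (_ : (1 - y)^-1 <= _); last first.
  by rewrite -[leRHS]invrK lef_pV2 ?posrE; lra.
apply: le_trans (h _); last by lra.
apply: ler_sum => i _; rewrite add0n binn ler_wpM2r ?exprn_ge0 // coef_absp.
exact: coef_root4_trunc_le.
Qed.

Lemma pade_rem_le n r y : (2 * r < n)%N -> 0 <= y <= 4^-1 ->
  (absp (pade_rem n r)).[y] <=
  y ^+ (2 * r).+1 / (4 ^+ r.+1 * (1 - y) ^+ r.+1)
  + 2 * (absp (padeB r)).[2 * y] / 2 ^+ n.
Proof.
move=> rn /andP[y0 y1]; set P := pade_rem n r; set B := padeB r.
(* Above degree n only f B contributes, since A has degree at most r. This tail [T] is small by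
   [absp_shrink]; the rest [L] starts in degree 2 r + 1. *)
set fB := root4_trunc n * B; set T := drop_poly n.+1 fB * 'X^(n.+1).
set L := \poly_(i < n.+1) `|P`_i|.
have Tk k : T`_k = if (k < n.+1)%N then 0 else fB`_k.
  by rewrite coefMXn; case: ltnP => // h; rewrite coef_drop_poly subnK.
have hT : (absp T).[y] <= 2 * (absp B).[2 * y] / 2 ^+ n.
  apply: le_trans (@absp_shrink _ _ n _ y0) _.
    by move=> k kn; rewrite Tk ltnS ltnW.
  rewrite ler_wpM2r ?invr_ge0 ?exprn_ge0 //.
  have y20 : 0 <= 2 * y by lra.
  apply: (@le_trans _ _ (absp fB).[2 * y]).
    by apply: horner_le => // i; rewrite !coef_absp Tk; case: ifP; rewrite ?normr0.
  apply: le_trans (abspM_le _ _ y20) _; rewrite ler_wpM2r //.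
    by apply: horner_ge0 => // i; rewrite coef_absp.
  by apply: absp_root4_trunc_le; lra.
have hL : L.[y] <= y ^+ (2 * r).+1 / (4 ^+ r.+1 * (1 - y) ^+ r.+1).
  rewrite (horner_coef_wide _ (size_poly _ _)).
  have e : n.+1 = ((2 * r).+1 + (n - 2 * r))%N by lia.
  have {1}-> : \sum_(i < n.+1) L`_i * y ^+ i
     = \sum_(j < n - 2 * r) `|P`_((2 * r).+1 + j)| * y ^+ ((2 * r).+1 + j).
    transitivity (\sum_(i < n.+1) `|P`_i| * y ^+ i).
      by apply: eq_bigr => i _; rewrite coef_poly ltn_ord.
    rewrite e big_split_ord /= big1 ?add0r // => i _.
    by rewrite pade_rem_low ?normr0 ?mul0r //; have := ltn_ord i; lia.
  set c := `|P`_((2 * r).+1)|.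
  (* By [pade_rem_lead], 4 (2 r + 1) C(2 r, r) c is [pade_const r], which is at most 1, and (2 r +
     1) C(2 r, r) is at least 4^r. *)
  have hc : c <= (4 ^+ r.+1)^-1.
    have hl := @pade_rem_lead R n r rn.
    have hb : 4 ^+ r <= (2 * r).+1%:R * 'C(2 * r, r)%:R :> R.
      by rewrite -natrM -natrX ler_nat central_bin_ge.
    have h0 : 0 < 4 ^+ r :> R by rewrite exprn_gt0.
    have c0 : 0 <= c by exact: normr_ge0.
    move: (pade_const r) (@pade_const_gt0 R r) (@pade_const_le1 R r) hl => w w0 w1.
    move/(congr1 Num.norm); rewrite !normrM !normr_nat (gtr0_norm w0) -/P -/c => hc.
    rewrite -[leRHS]mul1r ler_pdivlMr ?exprn_gt0 //; apply: le_trans w1.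
    by rewrite -hc exprS mulrC ler_wpM2r // -[leRHS]mulrA ler_wpM2l.
  have zs : (1 - y) ^+ r.+1 > 0 by rewrite exprn_gt0; lra.
  apply: (@le_trans _ _ (\sum_(j < n - 2 * r)
      (c * y ^+ (2 * r).+1) * ('C(r + j, j)%:R * y ^+ j))).
    apply: ler_sum => j _; rewrite exprD.
    have jn : ((2 * r).+1 + j <= n)%N by have := ltn_ord j; lia.
    have := @pade_rem_coef_le R n r j jn; rewrite -/P -/c => h.
    rewrite mulrA [leRHS]mulrA ler_wpM2r ?exprn_ge0 //.
    by rewrite mulrAC ler_wpM2r ?exprn_ge0 // mulrC.
  rewrite -mulr_sumr invfM mulrA.
  apply: ler_pM; rewrite ?sumr_ge0 ?mulr_ge0 ?exprn_ge0 ?normr_ge0 //.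
  - by move=> i _; rewrite mulr_ge0 ?exprn_ge0.
  - by rewrite mulrC ler_wpM2l ?exprn_ge0.
  - by apply: sum_neg_binomial_le; lra.
apply: le_trans (lerD hL hT); rewrite -hornerD horner_le // => i.
rewrite coefD !coef_absp coef_poly Tk; case: ltnP => h; first by rewrite normr0 addr0.
rewrite add0r coefB [(pade _ _)`_i]nth_default ?sub0r ?normrN //.
apply: leq_trans (size_pade _ _) _; lia.
Qed.

(** The difference h = f^4 - (1 - x) satisfies (1 - x) h' + h = e f^3 x^n and h(0) = 0, so its
    coefficients vanish one after another up to index n. *)
Lemma root4_trunc4_low n k : (k <= n)%N ->
  (root4_trunc n ^+ 4 - (1 - 'X) : {poly R})`_k = 0.
Proof.
set f := root4_trunc n; set h := f ^+ 4 - (1 - 'X).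
set e := ((1 - 4 * n%:R) * f`_n)%:P.
have hf : 4 * (1 - 'X) * f^`() + f = e * 'X^n := root4_trunc_ode n.
clearbody e.
have hh : h^`() - 'X * h^`() + h = e * f ^+ 3 * 'X^n.
  have f0 : forall g : {poly R}, 4 * (1 - 'X) * g^`() + g = e * 'X^n ->
     (g ^+ 4 - (1 - 'X))^`() - 'X * (g ^+ 4 - (1 - 'X))^`() + (g ^+ 4 - (1 - 'X))
      = e * g ^+ 3 * 'X^n.
    move=> g hg; rewrite -[g ^+ 4]/(g * (g * (g * g))) !poly.derivE.
    apply: (lincomb (c:=g^+3) hg); ring.
  exact: f0.
elim: k => [|k IH] kn.
  rewrite /h coefB coefB coefX coef1 subr0 -[_ ^+ 4]/(f * (f * (f * f))) !coef0M.
  by rewrite /f coef_root4_trunc // gbin0 /=; ring.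
have := congr1 (fun p : {poly R} => p`_k) hh.
rewrite coefMXn kn coefD coefB coefXM !coef_deriv IH ?(ltnW kn) // addr0.
have -> : (if k == 0 then 0 else h`_k.-1.+1 *+ k.-1.+1) = 0.
  case: k IH kn => [|k] IH kn //=.
  by rewrite IH ?(ltnW kn) // mul0rn.
by rewrite subr0 => /eqP; rewrite -mulr_natl mulf_eq0 pnatr_eq0 /= => /eqP.
Qed.

Lemma root4_trunc4_le n y : 0 <= y <= 4^-1 ->
  (absp (root4_trunc n ^+ 4 - (1 - 'X))).[y] <= 18 / 2 ^+ n.
Proof.
move=> /andP[y0 y1]; set f := root4_trunc n.
apply: le_trans (@absp_shrink _ _ n _ y0) _.
  by move=> k kn; apply: root4_trunc4_low; exact: ltnW.
rewrite ler_wpM2r ?invr_ge0 ?exprn_ge0 //.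
have z0 : 0 <= 2 * y by lra.
have hf : (absp f).[2 * y] <= 2 by apply: absp_root4_trunc_le; lra.
have hf0 : 0 <= (absp f).[2 * y] by apply: horner_ge0 => // i; rewrite coef_absp.
apply: (@le_trans _ _ ((absp (f ^+ 4)).[2 * y] + (1 + 'X).[2 * y])).
  rewrite -hornerD horner_le // => i; rewrite coefD !coef_absp coefB.
  rewrite (le_trans (ler_normB _ _)) // lerD2l coefB coefD.
  by rewrite (le_trans (ler_normB _ _)) // coef1 coefX !normr_nat.
have h2 : (absp (f ^+ 2)).[2 * y] <= 4.
  by rewrite expr2; apply: le_trans (abspM_le _ _ z0) _; rewrite (_ : 4 = 2 * 2) ?ler_pM //; ring.
have h20 : 0 <= (absp (f ^+ 2)).[2 * y] by apply: horner_ge0 => // i; rewrite coef_absp.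
have h4 : (absp (f ^+ 4)).[2 * y] <= 16.
  have -> : f ^+ 4 = f ^+ 2 * f ^+ 2 by rewrite -exprD.
  apply: le_trans (abspM_le _ _ z0) _; rewrite (_ : 16 = 4 * 4) ?ler_pM //; ring.
by rewrite -[1 in X in _ + X]polyC1 (hornerD 1%:P) hornerX hornerC; lra.
Qed.
End Majorants.

(** * Gaussian integers *)

Lemma logn2_fact_le k : (logn 2 k`! <= k)%N.
Proof.
rewrite logn_fact //.
(* In Legendre's formula the extra term k / 2^m makes the bound inductive: two copies of k / 2^(m+1)
   fit into it. *)
suff h m : (\sum_(1 <= i < m.+1) k %/ 2 ^ i + k %/ 2 ^ m <= k)%N.
  by apply: leq_trans (h k); rewrite leq_addr.
elim: m => [|m IH]; first by rewrite big_geq // expn0 divn1.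
apply: leq_trans IH; rewrite big_nat_recr //= -addnA leq_add2l expnSr divnMA.
by rewrite addnn -mul2n mulnC leq_trunc_div.
Qed.

(* The factors form an arithmetic progression whose difference 4 is invertible
   modulo the odd part of k!; the 2-part of k! divides 2 ^ k. *)
Lemma dvdz_fact_prod (a : int) (k : nat) :
  (k`!%:Z %| 2 ^+ k * \prod_(j < k) (a - 4 * j%:Z))%Z.
Proof.
have [m cop2m efact] := pfactor_coprime (isT : prime 2) (fact_gt0 k).
have copm : coprimez 4 m.
  have : coprime (2 ^ 2) m by rewrite coprimeXl.
  by rewrite /coprimez /gcdz /coprime => /eqP ->.
(* Modulo m the number a is 4 s, so the product becomes 4^k times the falling factorial of s, which
   k! divides. *)
have hs : exists (s : nat) (t : int), a = 4 * s%:Z + m%:Z * t.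
  have /coprimezP [[p q] /= epq] := copm.
  have m0 : m%:Z != 0.
    by apply/eqP => m0; move: (fact_gt0 k); rewrite efact (_ : m = 0%N) //; lia.
  exists `|((a * p) %% m)%Z|%N, (a * q + 4 * ((a * p) %/ m)%Z).
  rewrite gez0_abs ?modz_ge0 //.
  have := divz_eq (a * p) m => h.
  have {1}-> : a = a * (p * 4 + q * m) by rewrite epq mulr1.
  by rewrite mulrDr !mulrA {1}h; ring.
have [s [t ea]] := hs.
have [u eu] : exists w : int, \prod_(j < k) (a - 4 * j%:Z)
    = 4 ^+ k * \prod_(j < k) (s%:Z - j%:Z) + m%:Z * w.
  elim: k {efact copm cop2m} => [|k [w IH]].
    by exists 0; rewrite !big_ord0; ring.
  rewrite !big_ord_recr /= IH.
  exists (t * 4 ^+ k * \prod_(i < k) (s%:Z - i%:Z) + w * (4 * s%:Z + m%:Z * t - 4 * k%:Z)).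
  by rewrite {1}ea exprS; ring.
have es : \prod_(j < k) (s%:Z - j%:Z) = (s ^_ k)%:Z.
  rewrite ffact_prod; case: (leqP k s) => ks.
    rewrite -[RHS]natz natr_prod; apply: eq_bigr => j _; rewrite natz subzn //.
    by rewrite (leq_trans _ ks) // ltnW.
  by rewrite (bigD1 (Ordinal ks)) //= subrr mul0r (bigD1 (Ordinal ks)) //= subnn mul0n.
have dm : (m%:Z %| \prod_(j < k) (a - 4 * j%:Z))%Z.
  rewrite eu; apply: rpredD; last exact: dvdz_mulr.
  apply: dvdz_mull; rewrite es -bin_ffact efact !PoszM mulrCA.
  exact: dvdz_mulr.
have d2 : ((2 ^ logn 2 k`!)%N%:Z %| (2 : int) ^+ k)%Z.
  have -> : (2 : int) ^+ k = 2 ^+ logn 2 k`! * 2 ^+ (k - logn 2 k`!).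
    by rewrite -exprD subnKC // logn2_fact_le.
  rewrite -[(2 ^ _)%N%:Z]natz natrX.
  exact: dvdz_mulr.
by rewrite [X in (X%:Z %| _)%Z]efact PoszM mulrC dvdz_mul.
Qed.

Section GaussianIntegers.
Context {R : rcfType}.
Implicit Types (z w : R[i]).

Definition gaussian z := exists a b : int, z = a%:~R + b%:~R * 'i.

Lemma gaussian_int (a : int) : gaussian a%:~R.
Proof. by exists a, 0; rewrite mul0r addr0. Qed.

Lemma gaussian_nat n : gaussian n%:R.
Proof. by exists n%:Z, 0; rewrite mul0r addr0. Qed.

Lemma gaussian_i : gaussian 'i.
Proof. by exists 0, 1; rewrite add0r mul1r. Qed.

Lemma gaussianD z w : gaussian z -> gaussian w -> gaussian (z + w).
Proof. by move=> [a [b ->]] [c [d ->]]; exists (a + c), (b + d); ring. Qed.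

Lemma gaussianN z : gaussian z -> gaussian (- z).
Proof. by move=> [a [b ->]]; exists (- a), (- b); ring. Qed.

Lemma gaussianB z w : gaussian z -> gaussian w -> gaussian (z - w).
Proof. by move=> hz hw; apply: gaussianD => //; exact: gaussianN. Qed.

Lemma gaussianM z w : gaussian z -> gaussian w -> gaussian (z * w).
Proof.
move=> [a [b ->]] [c [d ->]]; exists (a * c - b * d), (a * d + b * c).
have h := @sqr_i R.
have -> : (a%:~R + b%:~R * 'i) * (c%:~R + d%:~R * 'i)
  = a%:~R * c%:~R + (a%:~R * d%:~R + b%:~R * c%:~R) * 'i + b%:~R * d%:~R * 'i ^+ 2 :> R[i] by ring.
rewrite h; ring.
Qed.

Lemma gaussianX z n : gaussian z -> gaussian (z ^+ n).
Proof.
move=> hz; elim: n => [|n IH]; first by rewrite expr0; exact: (gaussian_nat 1).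
by rewrite exprS; exact: gaussianM.
Qed.

Lemma gaussian_sum n (F : 'I_n -> R[i]) :
  (forall i, gaussian (F i)) -> gaussian (\sum_(i < n) F i).
Proof.
move=> hF; apply: (big_ind gaussian) => //; first exact: (gaussian_nat 0).
exact: gaussianD.
Qed.

Lemma normcD_le z w : normc (z + w) <= normc z + normc w.
Proof. exact: le_normcD. Qed.

Lemma normc_real (a : R) : normc a%:C = `|a|.
Proof. by rewrite /= expr0n /= addr0 sqrtr_sqr. Qed.

Lemma normcX z n : normc (z ^+ n) = normc z ^+ n.
Proof. by elim: n => [|n IH]; rewrite ?expr0 ?normc1 // !exprS normcM IH. Qed.

Lemma normc_ge0 z : 0 <= normc z.
Proof. by case: z => a b; exact: sqrtr_ge0. Qed.

Lemma normc_nat n : normc (n%:R : R[i]) = n%:R.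
Proof. by rewrite -(rmorph_nat (real_complex R)) normc_real normr_nat. Qed.

Lemma normc_i : normc ('i : R[i]) = 1.
Proof. by rewrite /= expr0n /= add0r expr1n sqrtr1. Qed.

Lemma complex_intE (a b : int) : a%:~R + b%:~R * 'i = a%:~R +i* b%:~R :> R[i].
Proof.
rewrite -2!(rmorph_int (real_complex R)); apply/eqP; rewrite eq_complex /=.
by rewrite !(mulr0, mul0r, mulr1, addr0, add0r, subr0) !eqxx.
Qed.

Lemma normc_gaussian_ge1 z : gaussian z -> z != 0 -> 1 <= normc z.
Proof.
move=> [a [b ->]]; rewrite complex_intE => z0.
have h : 1 <= (a%:~R : R) ^+ 2 + b%:~R ^+ 2.
  have -> : (a%:~R : R) ^+ 2 + b%:~R ^+ 2 = (a ^+ 2 + b ^+ 2)%:~R by ring.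
  rewrite ler1z; have : (a != 0) || (b != 0).
    by move: z0; rewrite eq_complex /= negb_and !intr_eq0.
  by nia.
rewrite -[leLHS](@sqrtr1 R) /normc ler_sqrt //.
exact: le_trans ler01 h.
Qed.

Lemma normc_sum_le n (F : 'I_n -> R[i]) :
  normc (\sum_(i < n) F i) <= \sum_(i < n) normc (F i).
Proof.
apply: (big_ind2 (fun z r => normc z <= r)) => //; first by rewrite normc0.
by move=> z r w q hz hw; rewrite (le_trans (normcD_le _ _)) // lerD.
Qed.

Definition cev (p : {poly R}) z : R[i] := (map_poly (real_complex R) p).[z].

Lemma cev_coef (p : {poly R}) n z : (size p <= n)%N ->
  cev p z = \sum_(i < n) (p`_i)%:C * z ^+ i.
Proof.
move=> sp; rewrite /cev (@horner_coef_wide _ n) ?size_map_poly //.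
by apply: eq_bigr => i _; rewrite coef_map.
Qed.

Lemma cevM p q z : cev (p * q) z = cev p z * cev q z.
Proof. by rewrite /cev rmorphM hornerM. Qed.

Lemma cevB p q z : cev (p - q) z = cev p z - cev q z.
Proof. by rewrite /cev rmorphB hornerD hornerN. Qed.

Lemma cevX p n z : cev (p ^+ n) z = cev p z ^+ n.
Proof. by rewrite /cev rmorphXn horner_exp. Qed.

Lemma normc_cev_le p z : normc (cev p z) <= (absp p).[normc z].
Proof.
rewrite (@cev_coef _ _ _ (leqnn _)) (le_trans (normc_sum_le _)) //.
rewrite (horner_coef_wide _ (size_poly _ _)) ler_sum // => i _.
by rewrite normcM normc_real normcX coef_absp.
Qed.

(** In the term of degree k the factor (4 u)^k turns (2 i / u)^k into 8^k i^k, and 8^k clears the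
    denominator of the generalized binomial by [dvdz_fact_prod]. *)
Lemma gaussian_cev_pade (s : R) (c : int) r u : 4 * s = c%:~R -> gaussian u -> u != 0 ->
  gaussian ((4 * u) ^+ r * cev (pade s r) (2 * 'i / u)).
Proof.
move=> hs hu u0; rewrite (cev_coef _ (size_pade _ _)) mulr_sumr.
apply: gaussian_sum => k; have kr : (k <= r)%N by rewrite -ltnS ltn_ord.
rewrite coef_poly ltn_ord.
have [d hd] : exists d : int, 8 ^+ k * gbin (r%:R + s) k = d%:~R.
  have /dvdzP [d hd] := dvdz_fact_prod (4 * r%:Z + c) k; exists d.
  have f0 : k`!%:R != 0 :> R by rewrite pnatr_eq0 -lt0n fact_gt0.
  rewrite /gbin mulrA; apply: (mulIf f0); rewrite divfK //.
  have := congr1 (fun n : int => n%:~R : R) hd.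
  rewrite !rmorphM /= => <-; rewrite rmorphXn rmorph_prod /=.
  have -> : (8 : R) = 2 * 4 by ring.
  rewrite exprMn -mulrA; congr (_ * _).
  rewrite -[X in _ ^+ X]card_ord -prodr_const -big_split /=.
  by apply: eq_bigr => j _; rewrite !(rmorphB, rmorphD, rmorphM) /= -hs; ring.
have -> : (4 * u) ^+ r * (((-1) ^+ k * gbin (r%:R + s) k * 'C(2 * r - k, r)%:R)%:C *
    (2 * 'i / u) ^+ k)
  = (4 * u) ^+ (r - k) * (-1) ^+ k * (8 ^+ k * gbin (r%:R + s) k)%:C
    * 'C(2 * r - k, r)%:R * 'i ^+ k.
  move: (gbin _ _) => g; rewrite !rmorphM !rmorphXn rmorphN !rmorph_nat rmorph1.
  rewrite -{1}(subnKC kr) exprD.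
  have uk : u ^+ k != 0 by rewrite expf_neq0.
  rewrite !exprMn exprVn.
  have -> : (8 : R[i]) ^+ k = 4 ^+ k * 2 ^+ k by rewrite -exprMn; congr (_ ^+ _); ring.
  by move: (u ^+ k) uk => U U0; field.
rewrite hd rmorph_int.
apply: gaussianM; last exact/gaussianX/gaussian_i.
apply: gaussianM; last exact: gaussian_nat.
apply: gaussianM; last exact: gaussian_int.
apply: gaussianM; apply: gaussianX.
  by apply: gaussianM => //; exact: (gaussian_nat 4).
by apply: gaussianN; exact: (gaussian_nat 1).
Qed.
End GaussianIntegers.

(** * The Thue-Siegel argument over the Gaussian integers *)

Section ThueGaussian.
Context {R : archiRcfType}.
Implicit Types (a b c d W : R[i]).

Local Notation padeA r := (pade (4%:R^-1 : R) r).
Local Notation padeB r := (pade (- 4%:R^-1 : R) r).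

Lemma sqr_close c d :
  normc (d - c) * normc d <= normc (d ^+ 2 - c ^+ 2) \/
  normc (d + c) * normc d <= normc (d ^+ 2 - c ^+ 2).
Proof.
have h2 : 2 * normc d <= normc (d - c) + normc (d + c).
  rewrite -[2](@normc_nat R) -normcM; have -> : 2%:R * d = (d - c) + (d + c) by ring.
  exact: normcD_le.
have -> : d ^+ 2 - c ^+ 2 = (d - c) * (d + c) by ring.
rewrite normcM; case: (lerP (normc (d - c)) (normc (d + c))) => h; [left|right].
  by rewrite ler_wpM2l ?normc_ge0 //; lra.
by rewrite [leRHS]mulrC ler_wpM2l ?normc_ge0 //; lra.
Qed.

(** The difference of fourth powers is factored twice as a difference of squares. Each time the
    larger factor is at least as big as its first square root, and the smaller one is kept. *)
Lemma quartic_close a b : exists j,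
  normc (b - 'i ^+ j * a) * normc b ^+ 3 <= normc (b ^+ 4 - a ^+ 4).
Proof.
have hi := @sqr_i R.
have key a' : normc (b ^+ 2 - a' ^+ 2) * normc b ^+ 2 <= normc (b ^+ 4 - a ^+ 4) ->
    exists2 s : R[i], s = 1 \/ s = -1 &
      normc (b - s * a') * normc b ^+ 3 <= normc (b ^+ 4 - a ^+ 4).
  move=> h; have b0 : 0 <= normc b ^+ 2 by rewrite exprn_ge0 ?normc_ge0.
  case: (sqr_close a' b) => h'; [exists 1; [by left|] | exists (-1); [by right|]];
    apply: le_trans h; rewrite ?mul1r ?mulN1r ?opprK exprS mulrA; exact: ler_wpM2r.
have h4 : (b ^+ 2) ^+ 2 - (a ^+ 2) ^+ 2 = b ^+ 4 - a ^+ 4 by rewrite -!exprM.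
case: (sqr_close (a ^+ 2) (b ^+ 2)); rewrite h4 normcX => h.
  have [s [->|->] hs] := key a h; first by exists 0%N; rewrite expr0.
  by exists 2%N; rewrite hi.
have [|s hs hle] := key ('i * a); first by rewrite exprMn hi mulN1r opprK.
case: hs => es; rewrite es in hle.
  by exists 1%N; rewrite expr1; rewrite mul1r in hle.
by exists 3%N; have -> : 'i ^+ 3 * a = -1 * ('i * a) by rewrite exprS hi; ring.
Qed.

Let u : R[i] := - 239 + 'i.
Let v : R[i] := - 239 - 'i.
Let x : R[i] := 2 * 'i / u.

Lemma normc_u2 : normc u ^+ 2 = 239 ^+ 2 + 1.
Proof.
have -> : u = (-239)%:~R + 1%:~R * 'i by rewrite /u; ring.
rewrite complex_intE /= sqr_sqrtr; first by ring.
by rewrite addr_ge0 ?sqr_ge0.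
Qed.

Lemma normc_u_bounds : 239 <= normc u <= 240.
Proof.
have h := normc_u2; have h0 := normc_ge0 u.
by apply/andP; split; nra.
Qed.

Lemma normc_v2 : normc v ^+ 2 = 239 ^+ 2 + 1.
Proof.
have -> : v = (-239)%:~R + (-1)%:~R * 'i by rewrite /v; ring.
rewrite complex_intE /= sqr_sqrtr; first by ring.
by rewrite addr_ge0 ?sqr_ge0.
Qed.

Lemma normc_v_le : normc v <= 240.
Proof. by have h := normc_v2; have h0 := normc_ge0 v; nra. Qed.

Lemma u_neq0 : u != 0.
Proof.
apply/eqP => h; have := normc_u2; rewrite h normc0 expr0n /= => /eqP.
by rewrite eq_sym gt_eqF // ltr_wpDl // exprn_ge0.
Qed.

Lemma normc_x : normc x = 2 / normc u.
Proof.
by rewrite /x normcM normcV ?u_neq0 // normcM normc_i normc_nat mulr1.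
Qed.

Lemma gaussian_u : gaussian u.
Proof.
apply: gaussianD; last exact: gaussian_i.
by apply: gaussianN; exact: (gaussian_nat 239).
Qed.

(** The cleared main remainder term equals (4 / (y - 2))^r / (2 (y - 2)), and y - 2 >= 237 gives
    both 4 / (y - 2) <= 1/59 and the constant 474. *)
Lemma pade_weight_rem r y t : 239 <= y -> t = 2 / y ->
  (4 * y) ^+ r * (t ^+ (2 * r).+1 / (4 ^+ r.+1 * (1 - t) ^+ r.+1))
    <= (59 ^+ r)^-1 / 474 :> R.
Proof.
move=> y0 ht.
have t1 : 0 < 1 - t by rewrite ht subr_gt0 ltr_pdivrMr; lra.
have -> : (4 * y) ^+ r * (t ^+ (2 * r).+1 / (4 ^+ r.+1 * (1 - t) ^+ r.+1))
  = (4 / (y - 2)) ^+ r * (2 * (y - 2))^-1.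
  have -> : 4 / (y - 2) = (4 * y) * t ^+ 2 * (4 * (1 - t))^-1.
    by rewrite ht; field; rewrite ?gt_eqF //; lra.
  have -> : (2 * (y - 2))^-1 = t * (4 * (1 - t))^-1.
    by rewrite ht; field; rewrite ?gt_eqF //; lra.
  rewrite -[4 ^+ r.+1 * _]exprMn; move: (4 * (1 - t)) (4 * y) => q p.
  by rewrite (exprS t) exprM (exprS q) invfM !exprMn exprVn; ring.
have y2 : 0 < y - 2 by lra.
apply: ler_pM; rewrite ?exprn_ge0 ?invr_ge0 ?divr_ge0 //; try lra.
  rewrite -exprVn lerXn2r ?nnegrE ?divr_ge0 ?invr_ge0 //; try lra.
  by rewrite ler_pdivrMr // mulrC ler_pdivlMr //; lra.
by rewrite lef_pV2 ?posrE; lra.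
Qed.

(** The base of the power is 16 (y + 1), and 16 times 241 is less than 16^3. *)
Lemma pade_weight_B r y t : 239 <= y <= 240 -> t = 2 / y ->
  (4 * y) ^+ r * (4 ^+ r * (1 + t / 2) ^+ r) <= (16 ^+ r) ^+ 3 :> R.
Proof.
move=> /andP[y0 y1] ht; rewrite -!exprMn.
have -> : 4 * y * (4 * (1 + t / 2)) = 16 * (y + 1) by rewrite ht; field; lra.
rewrite exprAC lerXn2r ?nnegrE ?exprn_ge0 //; lra.
Qed.

Lemma cev_root4_trunc n : normc x <= 4^-1 ->
  normc (cev (root4_trunc n) x ^+ 4 - (1 - x)) <= 18 / 2 ^+ n.
Proof.
move=> x4; have -> : cev (root4_trunc n) x ^+ 4 - (1 - x)
    = cev (root4_trunc n ^+ 4 - (1 - 'X)) x.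
  rewrite !cevB cevX; congr (_ - (_ - _)).
    by rewrite /cev rmorph1 hornerC.
  by rewrite /cev map_polyX hornerX.
apply: le_trans (normc_cev_le _ _) _; apply: root4_trunc4_le.
by rewrite normc_ge0.
Qed.

Lemma normc_3p2i_bounds : 36 <= 10 * normc (3 + 2 * 'i : R[i]) <= 37.
Proof.
have h : normc (3 + 2 * 'i : R[i]) ^+ 2 = 13.
  have -> : 3 + 2 * 'i = 3%:~R + 2%:~R * 'i :> R[i] by ring.
  rewrite complex_intE /= sqr_sqrtr; first by ring.
  by rewrite addr_ge0 ?sqr_ge0.
have h0 := normc_ge0 (3 + 2 * 'i : R[i]).
by apply/andP; split; nra.
Qed.

(* The difference of the two sides, times (4 u)^r, is a Gaussian integer of
   modulus less than 1. *)
Lemma pade_form_eq0 n r (a b s : R[i]) (y : R) :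
  gaussian a -> gaussian b -> gaussian s -> normc s = 1 ->
  36 * y <= 10 * normc a <= 37 * y -> 3 * 16 ^+ r <= y -> y <= 65 * 59 ^+ r ->
  (2 * r < n)%N ->
  40 * (4 * 240) ^+ r * y * (absp (padeB r)).[2 * normc x] <= 2 ^+ n ->
  normc (b - s * (cev (root4_trunc n) x * a)) * (46 * y ^+ 3) <= 239 + 2 ->
  cev (padeA r) x * (s * a) = cev (padeB r) x * b.
Proof.
move=> ga gb gs s1 /andP[ya1 ya] yr ry rn hK hb.
have /andP[u1 u2] := normc_u_bounds.
set t := normc x; have ht : t = 2 / normc u := normc_x.
have t0 : 0 <= t := normc_ge0 x.
have t4 : t <= 4^-1 by rewrite ht ler_pdivrMr; lra.
have r16 : 1 <= (16 : R) ^+ r by rewrite exprn_ege1 // ler1n.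
have y0 : 0 < y by lra.
apply/eqP; rewrite -subr_eq0; apply/eqP.
set A := cev (padeA r) x; set B := cev (padeB r) x; set f := cev _ x in hb.
set L := A * (s * a) - B * b.
suff : (4 * u) ^+ r * L = 0.
  by move/eqP; rewrite mulf_eq0 expf_eq0 mulf_eq0 pnatr_eq0 (negPf u_neq0) andbF => /eqP.
apply/eqP/negP => /negP ML0.
have GL : gaussian ((4 * u) ^+ r * L).
  have -> : (4 * u) ^+ r * L = ((4 * u) ^+ r * A) * (s * a) - ((4 * u) ^+ r * B) * b.
    by rewrite /L; ring.
  have h4 := @four_inv4 R.
  apply: gaussianB; apply: gaussianM; try exact: gaussianM; try by [].
    apply: (gaussian_cev_pade (c := 1)); rewrite ?h4 ?u_neq0 //; exact: gaussian_u.
  apply: (gaussian_cev_pade (c := -1)); rewrite ?mulrN ?h4 ?u_neq0 //; exact: gaussian_u.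
have := normc_gaussian_ge1 GL ML0.
(* The form splits into the Pade remainder at x and the distance from b to the rotated f a. *)
have -> : (4 * u) ^+ r * L = (4 * u) ^+ r * ((A - f * B) * (s * a))
     - (4 * u) ^+ r * (B * (b - s * (f * a))) by rewrite /L; ring.
move=> h1.
have {h1} : 1 <= (4 * normc u) ^+ r * normc (A - f * B) * normc a
    + (4 * normc u) ^+ r * normc B * normc (b - s * (f * a)).
  apply: le_trans h1 _; apply: le_trans (normcD_le _ _) _.
  rewrite normcN !normcM normcX normcM normc_nat s1 mul1r.
  by rewrite le_eqVlt; apply/orP; left; apply/eqP; ring.
set M := (4 * normc u) ^+ r.
have M0 : 0 <= M by rewrite exprn_ge0 //; lra.
have MB : M * normc B <= (16 ^+ r) ^+ 3.
  apply: le_trans (@pade_weight_B r (normc u) t _ ht); last by rewrite u1 u2.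
  rewrite ler_wpM2l // (le_trans (normc_cev_le _ _)) //.
  exact: absp_padeB_le.
have MR : M * normc (A - f * B) <= (59 ^+ r)^-1 / 474
    + M * (2 * (absp (padeB r)).[2 * t] / 2 ^+ n).
  apply: le_trans (_ : M * (absp (pade_rem n r)).[t] <= _).
    by rewrite ler_wpM2l // /A /B /f -cevM -cevB normc_cev_le.
  apply: le_trans (_ : M * (_ + _) <= _).
    by rewrite ler_wpM2l //; apply: pade_rem_le => //; rewrite t0 t4.
  by rewrite mulrDr lerD2r; apply: pade_weight_rem.
have B0 : 0 <= (absp (padeB r)).[2 * t].
  by apply: horner_ge0; [move=> i; rewrite coef_absp | lra].
have tail : M * (2 * (absp (padeB r)).[2 * t] / 2 ^+ n) * y <= 20^-1.
  have n0 : 0 < (2 : R) ^+ n by rewrite exprn_gt0.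
  have MM : M <= (4 * 240) ^+ r.
    by apply: lerXn2r; rewrite ?nnegrE; clear -u1 u2; lra.
  rewrite mulrA mulrAC ler_pdivrMr // -(ler_pM2l (_ : (0 : R) < 20)) // mulVKf ?pnatr_eq0 //.
  apply: le_trans hK; rewrite -!mulrA.
  have := ler_wpM2r (mulr_ge0 B0 (ltW y0)) MM.
  move: (absp _).[_] => ? ?; lra.
have main : (59 ^+ r)^-1 / 474 * y <= 65 / 474.
  have p0 : 0 < (59 : R) ^+ r by rewrite exprn_gt0.
  rewrite mulrAC; apply: ler_wpM2r; first by rewrite invr_ge0 ler0n.
  by rewrite mulrC ler_pdivrMr.
(* The bound is 241 / (46 times 27), which is below 1/4: the weight 16^(3 r) is absorbed by y >= 3
   16^r. *)
have half : M * normc B * normc (b - s * (f * a)) <= 4^-1.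
  set d := normc _ in hb *.
  have d0 : 0 <= d := normc_ge0 _.
  have y3 : (3 * 16 ^+ r) ^+ 3 <= y ^+ 3 by rewrite lerXn2r ?nnegrE //; lra.
  apply: (@le_trans _ _ ((16 ^+ r) ^+ 3 * d)); first by rewrite ler_wpM2r.
  move: y3; rewrite exprMn; set w := (16 ^+ r) ^+ 3 => y3.
  have w0 : 0 < w by rewrite !exprn_gt0.
  have : d * (46 * (3 ^+ 3 * w)) <= 239 + 2.
    by apply: le_trans hb; rewrite ler_wpM2l //; lra.
  by lra.
(* This is less than 0.70; together with the 1/4 of [half] the modulus stays below 1. *)
have : M * normc (A - f * B) * normc a <= 37 / 10 * (65 / 474 + 20^-1) .
  apply: le_trans (_ : ((59 ^+ r)^-1 / 474
    + M * (2 * (absp (padeB r)).[2 * t] / 2 ^+ n)) * (37 / 10 * y) <= _).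
    apply: ler_pM => //; rewrite ?mulr_ge0 ?normc_ge0 //; lra.
  move: (_ / 474) (M * (_ / _)) main tail => p q; lra.
lra.
Qed.
End ThueGaussian.

Section ThueGaussianBound.
Context {R : archiRcfType}.
Implicit Types (W : R[i]).

Local Notation padeA r := (pade (4%:R^-1 : R) r).
Local Notation padeB r := (pade (- 4%:R^-1 : R) r).
Local Notation u := (- 239 + 'i : R[i]).
Local Notation v := (- 239 - 'i : R[i]).
Local Notation x := (2 * 'i / u : R[i]).

Lemma gaussian_num_u : (1 + 'i) * (3 + 2 * 'i) ^+ 4 = u.
Proof.
have hi : 'i ^+ 2 = -1 :> R[i] := @sqr_i R.
have h1 : (3 + 2 * 'i) ^+ 2 = 5 + 12 * 'i :> R[i] by apply: (lincomb (c := (4 : R[i])) hi); ring.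
have h2 : (5 + 12 * 'i) ^+ 2 = - 119 + 120 * 'i :> R[i].
  by apply: (lincomb (c := (144 : R[i])) hi); ring.
have -> : (3 + 2 * 'i) ^+ 4 = ((3 + 2 * 'i) ^+ 2) ^+ 2 :> R[i] by rewrite -exprM.
by rewrite h1 h2; apply: (lincomb (c := (120 : R[i])) hi); ring.
Qed.

Lemma gaussian_num_v : (1 - 'i) * (3 - 2 * 'i) ^+ 4 = v.
Proof.
have hi : 'i ^+ 2 = -1 :> R[i] := @sqr_i R.
have h1 : (3 - 2 * 'i) ^+ 2 = 5 - 12 * 'i :> R[i] by apply: (lincomb (c := (4 : R[i])) hi); ring.
have h2 : (5 - 12 * 'i) ^+ 2 = - 119 - 120 * 'i :> R[i].
  by apply: (lincomb (c := (144 : R[i])) hi); ring.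
have -> : (3 - 2 * 'i) ^+ 4 = ((3 - 2 * 'i) ^+ 2) ^+ 2 :> R[i] by rewrite -exprM.
by rewrite h1 h2; apply: (lincomb (c := (120 : R[i])) hi); ring.
Qed.

Lemma normc_3m2i : normc (3 - 2 * 'i : R[i]) = normc (3 + 2 * 'i : R[i]).
Proof.
have -> : 3 - 2 * 'i = 3%:~R + (-2)%:~R * 'i :> R[i] by ring.
have -> : 3 + 2 * 'i = 3%:~R + 2%:~R * 'i :> R[i] by ring.
by rewrite !complex_intE /= mulrNz sqrrN.
Qed.

Lemma one_sub_x : 1 - x = v / u.
Proof. by have := @u_neq0 R => u0; field. Qed.

Lemma normc_x_le : normc x <= 4^-1.
Proof.
by have /andP[u1 u2] := @normc_u_bounds R; rewrite normc_x ler_pdivrMr; lra.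
Qed.

(** With this r both r and r + 1 meet the size conditions of [pade_form_eq0]: 48 16^r is 3 16^(r+1),
    and by [scale_growth] the upper bound is at most 65 59^r. *)
Lemma exists_scale (y : R) : 48 * 16 ^+ 3 <= y ->
  exists2 r, (3 <= r)%N & 48 * 16 ^+ r <= y < 48 * 16 ^+ r.+1.
Proof.
move=> hy; pose P m := y < 48 * 16 ^+ m.
have exP : exists m, P m.
  exists (Num.bound y); have h1 := upper_nthrootP (leqnn (Num.bound y)).
  apply: lt_le_trans h1 _.
  rewrite -[leLHS]mul1r; apply: ler_pM; rewrite ?exprn_ge0 //; first lra.
  by rewrite lerXn2r ?nnegrE; lra.
case: (ex_minnP exP) => m Pm minm.
have m4 : (3 < m)%N.
  rewrite ltnNge; apply/negP => m3; move: Pm; rewrite /P ltNge => /negP; apply.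
  apply: le_trans hy; rewrite ler_wpM2l // ler_weXn2l //; lra.
case: m m4 Pm minm => // m m4 Pm minm; exists m => //.
move: Pm; rewrite /P => ->; rewrite andbT leNgt; apply/negP => h.
by have := minm m h; rewrite ltnn.
Qed.

Lemma scale_growth r : (3 <= r)%N -> 48 * 16 ^+ r.+1 <= 65 * 59 ^+ r :> R.
Proof.
elim: r => // r IH; rewrite leq_eqVlt => /orP[/eqP [<-]|]; first lra.
rewrite ltnS => /IH {}IH; rewrite !(exprS _ r.+1) (exprS 59).
have : 0 < (16 : R) ^+ r.+1 by rewrite exprn_gt0.
by move: (16 ^+ r.+1) (59 ^+ r) IH => p q; lra.
Qed.

Lemma normc_expi j : normc ('i ^+ j : R[i]) = 1.
Proof. by rewrite normcX normc_i expr1n. Qed.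

(* For a larger W the forms of two consecutive indices r and r + 1 vanish, which
   contradicts pade_det. *)
Lemma thue_gaussian_bound W Wc (e : R[i]) :
  gaussian W -> gaussian Wc -> normc Wc = normc W -> normc e = 1 ->
  (1 + 'i) * W ^+ 4 - (1 - 'i) * Wc ^+ 4 = 2 * e -> normc W < 48 * 16 ^+ 3.
Proof.
move=> gW gWc eWc e1 hW; rewrite ltNge; apply/negP => hy.
have [r r3 /andP[yr ry]] := exists_scale hy; set y := normc W in hy yr ry.
have r16 : 1 <= (16 : R) ^+ r by rewrite exprn_ege1 // ler1n.
have y0 : 0 < y by lra.
(* [K] and [K'] collect the truncation errors for the indices r and r + 1 and for the fourth power
   of f; n is then chosen so that 2^n exceeds their sum. *)
pose K s := 40 * (4 * 240) ^+ s * y * (absp (padeB s)).[2 * normc x].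
pose K' := 18 * (37 / 10 * y) ^+ 4.
have K0 s : 0 <= K s.
  apply: mulr_ge0.
    apply: mulr_ge0; last exact: ltW.
    by apply: mulr_ge0; rewrite ?exprn_ge0 ?mulr_ge0 ?ler0n.
  by apply: horner_ge0; [move=> i; rewrite coef_absp | rewrite mulr_ge0 ?normc_ge0].
have K'0 : 0 <= K' by rewrite mulr_ge0 // exprn_ge0 //; lra.
have [n nr hn] : exists2 n, (2 * r.+1 < n)%N & K r + K r.+1 + K' < 2 ^+ n.
  exists (maxn (2 * r.+1).+1 (Num.bound (K r + K r.+1 + K'))); first exact: leq_maxl.
  by apply: upper_nthrootP; exact: leq_maxr.
have K1 := K0 r; have K2 := K0 r.+1.
set f := cev (root4_trunc n) x.
(* Then 2 a^4 = (1 - i) Wc^4 u and 2 b^4 = (1 + i) W^4 v, so the hypothesis reads b^4 - (v / u) a^4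
   = v e, and b is close to f a up to a power of i. *)
pose a := Wc * (3 + 2 * 'i); pose b := W * (3 - 2 * 'i).
have [j hj] := quartic_close (f * a) b.
have /andP[rho1 rho2] := @normc_3p2i_bounds R.
set rho := normc _ in rho1 rho2.
have rho0 : 0 <= rho := normc_ge0 _.
have na : normc a = y * rho by rewrite normcM eWc.
have nb : normc b = y * rho by rewrite normcM normc_3m2i.
have u0 := @u_neq0 R.
have /andP[u1 u2] := @normc_u_bounds R.
have x4 := normc_x_le.
pose h := f ^+ 4 - (1 - x).
have hh : normc h <= 18 / 2 ^+ n by exact: cev_root4_trunc.
have eq4 : b ^+ 4 - (f * a) ^+ 4 = v * e - h * a ^+ 4.
  have ea : 2 * a ^+ 4 = (1 - 'i) * Wc ^+ 4 * u.
    rewrite -gaussian_num_u /a exprMn; have hi : 'i ^+ 2 = -1 :> R[i] := @sqr_i R.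
    by apply: (lincomb (c := (Wc ^+ 4 * (3 + 2 * 'i) ^+ 4 : R[i])) hi); ring.
  have eb : 2 * b ^+ 4 = (1 + 'i) * W ^+ 4 * v.
    rewrite -gaussian_num_v /b exprMn; have hi : 'i ^+ 2 = -1 :> R[i] := @sqr_i R.
    by apply: (lincomb (c := (W ^+ 4 * (3 - 2 * 'i) ^+ 4 : R[i])) hi); ring.
  have ef : f ^+ 4 = v / u + h by rewrite /h one_sub_x; ring.
  have n2 : (2 : R[i]) != 0 by rewrite pnatr_eq0.
  have efa : 2 * ((v / u + h) * a ^+ 4) = v * ((1 - 'i) * Wc ^+ 4) + 2 * h * a ^+ 4.
    have -> : 2 * ((v / u + h) * a ^+ 4) = v / u * (2 * a ^+ 4) + 2 * h * a ^+ 4 by ring.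
    by rewrite ea; field.
  apply: (mulfI n2); rewrite mulrBr eb exprMn ef efa.
  apply: (lincomb (c := (v : R[i])) hW); ring.
have ga : gaussian a.
  apply: gaussianM => //; apply: gaussianD; first exact: (gaussian_nat 3).
  by apply: gaussianM; [exact: (gaussian_nat 2) | exact: gaussian_i].
have gb : gaussian b.
  apply: gaussianM => //; apply: gaussianB; first exact: (gaussian_nat 3).
  by apply: gaussianM; [exact: (gaussian_nat 2) | exact: gaussian_i].
have gs : gaussian ('i ^+ j : R[i]) by apply: gaussianX; exact: gaussian_i.
clearbody a b h.
(* The modulus of b is at least 3.6 y, and 3.6^3 > 46. On the right, 240 bounds v e and 1 bounds the
   truncation error h a^4. *)
have hb : normc (b - 'i ^+ j * (f * a)) * (46 * y ^+ 3) <= 239 + 2.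
  have y3 : 0 < y ^+ 3 by rewrite exprn_gt0.
  apply: (@le_trans _ _ (normc (b ^+ 4 - (f * a) ^+ 4))).
    apply: le_trans hj; rewrite ler_wpM2l ?normc_ge0 // nb exprMn mulrC.
    rewrite ler_wpM2l ?(ltW y3) //.
    have h46 : 46 <= (36 / 10 : R) ^+ 3 by clear; lra.
    apply: le_trans h46 _; clear -rho1.
    by rewrite lerXn2r ?nnegrE //; lra.
  rewrite eq4 (le_trans (normcD_le _ _)) // normcN (normcM v) (normcM h) e1 mulr1 normcX na.
  have -> : 239 + 2 = 240 + 1 :> R by clear; lra.
  apply: lerD; first exact: normc_v_le.
  apply: (@le_trans _ _ (18 / 2 ^+ n * (37 / 10 * y) ^+ 4)).
    apply: ler_pM; rewrite ?normc_ge0 ?exprn_ge0 ?mulr_ge0 ?normc_ge0 ?(ltW y0) //.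
    clear -y0 rho2 rho0; rewrite lerXn2r ?nnegrE ?mulr_ge0 ?(ltW y0) //; try lra.
    by rewrite mulrC ler_wpM2r ?(ltW y0) //; lra.
  by rewrite mulrAC ler_pdivrMr ?exprn_gt0 // mul1r -/K' (le_trans _ (ltW hn)) // lerDr addr_ge0.
have nay : 36 * y <= 10 * normc a <= 37 * y.
  by rewrite na; clear -rho1 rho2 y0; apply/andP; split; nra.
have gr := scale_growth r3.
have y16 : 3 * 16 ^+ r.+1 <= y by clear -yr; rewrite exprS; lra.
have y59 : y <= 65 * 59 ^+ r by exact: le_trans (ltW ry) gr.
have y59' : y <= 65 * 59 ^+ r.+1.
  by apply: le_trans y59 _; rewrite ler_wpM2l // ler_weXn2l //; clear; lra.
have y16' : 3 * 16 ^+ r <= y.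
  by apply: le_trans y16; rewrite ler_wpM2l // ler_weXn2l //; clear; lra.
have E1 : cev (padeA r) x * ('i ^+ j * a) = cev (padeB r) x * b.
  apply: (@pade_form_eq0 R n r a b _ y) => //; rewrite ?normc_expi //.
    by rewrite (leq_trans _ nr) // ltnS leq_mul.
  by rewrite -/(K r) (le_trans _ (ltW hn)) // -addrA lerDl addr_ge0.
have E2 : cev (padeA r.+1) x * ('i ^+ j * a) = cev (padeB r.+1) x * b.
  apply: (@pade_form_eq0 R n r.+1 a b _ y) => //; rewrite ?normc_expi //.
  by rewrite -/(K r.+1) (le_trans _ (ltW hn)) // addrAC lerDr addr_ge0.
have [d d0 hd] := @pade_det R r.
have := congr1 (fun p => cev p x) hd; rewrite cevB !cevM.
have b0 : b != 0.
  apply/eqP => b0; have := nb; rewrite b0 normc0 => /esym/eqP.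
  by rewrite mulf_eq0 gt_eqF //= => /eqP r0; move: rho1; rewrite r0; clear; lra.
have -> : cev (padeA r) x * cev (padeB r.+1) x - cev (padeA r.+1) x * cev (padeB r) x = 0.
  apply: (mulIf b0); move: (cev (padeA r) x) (cev (padeB r) x) E1 => A B E1.
  move: (cev (padeA r.+1) x) (cev (padeB r.+1) x) E2 => A' B' E2.
  apply: (lincomb2 (c := (A' : R[i])) (d := (- A : R[i])) E1 E2); ring.
move/esym/eqP; rewrite mulf_eq0 cevX /cev map_polyC hornerC map_polyX hornerX /=.
have -> : d%:C == 0 = false.
  by apply: negbTE; rewrite fmorph_eq0.
rewrite expf_eq0 !mulf_eq0 invr_eq0 pnatr_eq0 /= (negPf u0) orbF.
by apply/negP; rewrite eq_complex /= oner_eq0 andbF.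
Qed.
End ThueGaussianBound.

(** * Ljunggren's equation *)

Lemma coprime_mul_sqr m n k : coprime m n -> (m * n = k ^ 2)%N -> exists p, (m = p ^ 2)%N.
Proof.
move=> cop e; exists (gcdn m k).
have eg : (k * gcdn m k = m * gcdn k n)%N.
  by rewrite !muln_gcdr mulnn -e mulnC.
rewrite -mulnn muln_gcdl eg -muln_gcdr.
suff -> : gcdn (gcdn m k) (gcdn k n) = 1%N by rewrite muln1.
apply/eqP; rewrite -dvdn1; move/eqP: cop => <-.
by rewrite dvdn_gcd (dvdn_trans (dvdn_gcdl _ _)) ?dvdn_gcdl // (dvdn_trans (dvdn_gcdr _ _)) ?dvdn_gcdr.
Qed.

Lemma pythagorean_parametrization a b c : coprime a b -> ~~ odd b ->
  (a ^ 2 + b ^ 2 = c ^ 2)%N ->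
  exists p q, [/\ coprime p q, (a + q ^ 2 = p ^ 2)%N, (b = 2 * (p * q))%N
    & (c = p ^ 2 + q ^ 2)%N].
Proof.
move=> cop evb e.
have oa : odd a.
  apply: contraT => eva; move: cop; rewrite /coprime => /eqP g.
  have : (2 %| gcdn a b)%N by rewrite dvdn_gcd !dvdn2 eva evb.
  by rewrite g.
have ac : (a <= c)%N by nia.
have oc : odd c.
  have : odd (c ^ 2) by rewrite -e oddD !oddX /= oa (negPf evb).
  by rewrite oddX.
pose m := ((c + a)./2)%N; pose n := ((c - a)./2)%N; pose h := (b./2)%N.
have eb : b = (2 * h)%N by rewrite mul2n /h; have := odd_double_half b; rewrite (negPf evb).
have em : (c + a = 2 * m)%N.
  by rewrite mul2n /m; have := odd_double_half (c + a); rewrite oddD oa oc.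
have en : (c - a = 2 * n)%N.
  by rewrite mul2n /n; have := odd_double_half (c - a); rewrite oddB // oa oc.
have ec : c = (m + n)%N by lia.
have ea : a = (m - n)%N by lia.
have nm : (n <= m)%N by lia.
have emn : (m * n = h ^ 2)%N by move: e; rewrite ec ea eb; nia.
have copmn : coprime m n.
  have dh : (gcdn m n %| h)%N.
    by rewrite -(dvdn_pexp2r _ _ (isT : 0 < 2)%N) -emn -mulnn dvdn_mul ?dvdn_gcdl ?dvdn_gcdr.
  rewrite /coprime -dvdn1; move/eqP: cop => <-; rewrite dvdn_gcd.
  by rewrite ea eb dvdn_sub ?dvdn_gcdl ?dvdn_gcdr //= dvdn_mull.
have [p ep] := coprime_mul_sqr copmn emn.
have [q eq] : exists q, (n = q ^ 2)%N.
  by apply: (@coprime_mul_sqr n m h); rewrite 1?coprime_sym // mulnC.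
exists p, q; split.
- by move: copmn; rewrite ep eq coprime_pexpl // coprime_pexpr.
- by rewrite -ep -eq; lia.
- rewrite eb; congr (2 * _)%N; apply/eqP.
  by rewrite -(eqn_exp2r _ _ (isT : 0 < 2)%N) -emn ep eq expnMn.
- by rewrite -ep -eq.
Qed.

(** The pair of coordinates of (1 + s) (3 + 2 s)^k, with s = sqrt 2. *)
Fixpoint pell (k : nat) : nat * nat :=
  if k is k'.+1 then let: (x, v) := pell k' in (3 * x + 4 * v, 2 * x + 3 * v)%N
  else (1, 1)%N.

(** Descent: multiplication by 3 - 2 s, the inverse of 3 + 2 s, gives a solution with smaller v as
    long as v > 1. *)
Lemma pell_complete x v : (x ^ 2 + 1 = 2 * v ^ 2)%N -> exists k, pell k = (x, v).
Proof.
elim/ltn_ind: v x => v IH x e.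
have [v1|v1] := leqP v 1.
  case: v v1 {IH} e => [|[|//]] _; first by rewrite addn1.
  by case: x => [|[|x]] // e; [exists 0%N | exfalso; nia].
have v2 : v <> 2%N.
  move=> v2; move: e; rewrite v2; case: (leqP x 2) => h; last nia.
  by case: x h => [|[|[|//]]].
have v3 : (2 < v)%N by lia.
have h1 : (4 * v < 3 * x)%N by nia.
have h2 : (2 * x < 3 * v)%N by nia.
have h3 : (v < x)%N by nia.
have hlt : (3 * v - 2 * x < v)%N by lia.
have he : ((3 * x - 4 * v) ^ 2 + 1 = 2 * (3 * v - 2 * x) ^ 2)%N.
  have [a ha] : exists a, (3 * x = 4 * v + a)%N by exists (3 * x - 4 * v)%N; lia.
  have [b hb] : exists b, (3 * v = 2 * x + b)%N by exists (3 * v - 2 * x)%N; lia.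
  have -> : (3 * v - 2 * x = b)%N by lia.
  have -> : (3 * x - 4 * v = a)%N by lia.
  have ex : x = (3 * a + 4 * b)%N by lia.
  have ev : v = (2 * a + 3 * b)%N by lia.
  move: e; rewrite ex ev; clear; nia.
have [k hk] := IH _ hlt _ he.
by exists k.+1; rewrite /= hk; congr (_, _); lia.
Qed.

Lemma pell_ge k : (5 ^ k <= (pell k).2)%N /\ ((pell k).2 <= (pell k).1)%N.
Proof.
elim: k => [//|k]; rewrite /= expnS; case: (pell k) => x v /= [h1 h2].
by split; lia.
Qed.

Fixpoint pell_mod (M k : nat) : nat * nat :=
  if k is k'.+1 then let: (x, v) := pell_mod M k' in
    ((3 * x + 4 * v) %% M, (2 * x + 3 * v) %% M)%N
  else (1 %% M, 1 %% M)%N.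

Lemma pell_modE M k : pell_mod M k = ((pell k).1 %% M, (pell k).2 %% M)%N.
Proof.
elim: k => [//|k IH] /=; rewrite IH; case: (pell k) => x v /=.
by rewrite -[in LHS]modnDm !modnMmr -[in LHS](modnDm (2 * _)) !modnMmr !modnDm.
Qed.

Lemma pell_not_square k y : (k < 32)%N -> (pell k).2 = (y ^ 2)%N -> k = 0%N \/ k = 3%N.
Proof.
move=> k32 ey.
(* The modulus M certifies that the k-th value is no square when it is a quadratic nonresidue modulo
   M. Indices 0 and 3 carry the squares 1 and 169. *)
pose bad M k := (0 < M)%N && all (fun t => (t ^ 2 %% M)%N != (pell_mod M k).2) (iota 0 M).
have hbad M : ~~ bad M k.
  rewrite negb_and; case: (posnP M) => //= M0; apply/allPn; exists (y %% M)%N.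
    by rewrite mem_iota ltn_mod.
  by rewrite negbK pell_modE /= ey modnXm.
have : all (fun k => (k \in [:: 0; 3]) || has (bad^~ k) [:: 21; 31; 13; 19]) (iota 0 32)%N.
  by vm_compute.
move/allP/(_ k); rewrite mem_iota add0n => /(_ k32) /orP[|/hasP[M _]].
  by rewrite !inE => /orP[] /eqP; [left|right].
by move/negP: (hbad M).
Qed.

Section Ljunggren.
Local Notation C := (complex realalg).

Lemma gaussian_mn (m n : nat) : gaussian (m%:R + n%:R * 'i : C).
Proof. by exists m%:Z, n%:Z. Qed.

Lemma gaussian_mn' (m n : nat) : gaussian (m%:R - n%:R * 'i : C).
Proof. by exists m%:Z, (- n%:Z); rewrite mulrNz mulNr. Qed.

Lemma normc_mn2 (m n : nat) : normc (m%:R + n%:R * 'i : C) ^+ 2 = (m ^ 2 + n ^ 2)%:R.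
Proof.
rewrite (_ : m%:R + n%:R * 'i = m%:~R + n%:~R * 'i) // complex_intE /=.
by rewrite sqr_sqrtr ?addr_ge0 ?sqr_ge0 // natrD !natrX.
Qed.

Lemma normc_mn2' (m n : nat) :
  normc (m%:R - n%:R * 'i : C) = normc (m%:R + n%:R * 'i : C).
Proof.
have -> : m%:R - n%:R * 'i = (m%:Z)%:~R + (- n%:Z)%:~R * 'i :> C.
  by rewrite mulrNz mulNr.
rewrite (_ : m%:R + n%:R * 'i = m%:~R + n%:~R * 'i) // !complex_intE /=.
by rewrite mulrNz sqrrN.
Qed.

(** With w = m + n i one has w^2 = p + q i, and (1 + i) w^4 has imaginary part p^2 - q^2 + 2 p q;
    the other sign belongs to the conjugate of w. The conclusion is the Thue bound squared. *)
Lemma thue_nat_bound (m n p q : nat) : (p + n ^ 2 = m ^ 2)%N -> (q = 2 * (m * n))%N ->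
  absz ((p ^ 2)%N%:Z - (q ^ 2)%N%:Z - 2 * (p * q)%N%:Z)%R = 1%N
  \/ absz ((p ^ 2)%N%:Z - (q ^ 2)%N%:Z + 2 * (p * q)%N%:Z)%R = 1%N ->
  (m ^ 2 + n ^ 2 < 48 ^ 2 * (2 ^ 4) ^ 6)%N.
Proof.
move=> ep eq hE.
have hi : 'i ^+ 2 = -1 :> C := @sqr_i _.
have eP : (p%:R : C) = m%:R ^+ 2 - n%:R ^+ 2 by rewrite -!natrX -ep natrD addrK.
have eQ : (q%:R : C) = 2 * m%:R * n%:R by rewrite eq !natrM mulrA.
have w2 : (m%:R + n%:R * 'i) ^+ 2 = p%:R + q%:R * 'i :> C.
  by rewrite eP eQ; apply: (lincomb (c := (n%:R ^+ 2 : C)) hi); ring.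
have w2' : (m%:R - n%:R * 'i) ^+ 2 = p%:R - q%:R * 'i :> C.
  by rewrite eP eQ; apply: (lincomb (c := (n%:R ^+ 2 : C)) hi); ring.
have x4 (x : C) : x ^+ 4 = (x ^+ 2) ^+ 2 by rewrite -exprM.
have bound : normc (m%:R + n%:R * 'i : C) < 48 * 16 ^+ 3.
  have n1 (z : int) : absz z = 1%N -> normc ('i * z%:~R : C) = 1.
    move=> hz; rewrite normcM normc_i mul1r -(rmorph_int (real_complex realalg)).
    by rewrite normc_real -intr_norm -abszE hz.
  case: hE => hE.
    rewrite -normc_mn2'.
    apply: (@thue_gaussian_bound _ _ (m%:R + n%:R * 'i) _ _ _ _ (n1 _ hE)).
    - exact: gaussian_mn'.
    - exact: gaussian_mn.
    - by rewrite normc_mn2'.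
    rewrite !x4 w2 w2'.
    apply: (lincomb (c := (2 * 'i * q%:R ^+ 2 : C)) hi); ring.
  apply: (@thue_gaussian_bound _ _ (m%:R - n%:R * 'i) _ _ _ _ (n1 _ hE)).
  - exact: gaussian_mn.
  - exact: gaussian_mn'.
  - by rewrite normc_mn2'.
  rewrite !x4 w2 w2'.
  apply: (lincomb (c := (2 * 'i * q%:R ^+ 2 : C)) hi); ring.
rewrite -(ltr_nat realalg) -normc_mn2 natrM !natrX.
have -> : 48 ^+ 2 * (2 ^+ 4) ^+ 6 = (48 * 16 ^+ 3) ^+ 2 :> realalg.
  have -> : (16 : realalg) = 2 ^+ 4 by ring.
  by move: (2 ^+ 4) => z; ring.
by rewrite ltrXn2r ?nnegrE ?normc_ge0.
Qed.

(* The bases stay variables here so that nothing evaluates the powers in unary. *)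
Lemma leq_bound_exp (a t f : nat) : (a ^ 2 <= f ^ 5 -> t ^ 9 <= f ^ 4 -> t ^ 6 <= f ^ 3 ->
  (a ^ 2 * (t ^ 4) ^ 6) ^ 2 <= f ^ 32)%N.
Proof.
move=> h1 h2 h3.
have -> : ((t ^ 4) ^ 6 = (t ^ 9) ^ 2 * t ^ 6)%N by rewrite -!expnM -expnD.
have -> : (f ^ 32 = (f ^ 5 * ((f ^ 4) ^ 2 * f ^ 3)) ^ 2)%N.
  by rewrite -!expnM -!expnD -expnM.
by rewrite leq_exp2r // leq_mul // leq_mul // leq_exp2r.
Qed.

Lemma lt_exp_of_lt_bound k y : (5 ^ k <= y ^ 2 -> y < 48 ^ 2 * (2 ^ 4) ^ 6 -> k < 32)%N.
Proof.
(* It suffices that 48^2 <= 5^5, 2^9 <= 5^4 and 2^6 <= 5^3. *)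
have : ((48 ^ 2 * (2 ^ 4) ^ 6) ^ 2 <= 5 ^ 32)%N by exact: leq_bound_exp.
move: (48 ^ 2 * _)%N => B hB hk hy; rewrite -(@ltn_exp2l 5 k 32 isT).
apply: leq_ltn_trans hk _; apply: leq_trans hB.
by rewrite ltn_exp2r.
Qed.

Theorem ljunggren x y : (x ^ 2 + 1 = 2 * y ^ 4)%N -> y = 1%N \/ y = 13%N.
Proof.
move=> e; have e' : (x ^ 2 + 1 = 2 * (y ^ 2) ^ 2)%N by rewrite -expnM.
have ylt : (y < 48 ^ 2 * (2 ^ 4) ^ 6)%N.
  have ox : odd x.
    have : odd (x ^ 2 + 1) = false by rewrite e oddM.
    by rewrite oddD oddX /=; case: (odd x).
  pose s := x./2; have es : x = (2 * s + 1)%N.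
    by have := odd_double_half x; rewrite ox -/s; lia.
  (* The equation becomes a Pythagorean triple with consecutive legs and hypotenuse y^2. *)
  have e2 : (s ^ 2 + s.+1 ^ 2 = (y ^ 2) ^ 2)%N by move: e'; rewrite es; nia.
  have cops : coprime s s.+1 by rewrite coprimenS.
  (* Here p, q parametrize the first triple, so p^2 + q^2 = y^2 is again Pythagorean, and the
     consecutive legs give p^2 - q^2 - 2 p q = 1 or -1. The parametrization asks for an even second
     leg, so p and q may swap roles. *)
  have key (p q : nat) : coprime p q -> (p ^ 2 + q ^ 2 = y ^ 2)%N ->
      (p ^ 2 = q ^ 2 + 2 * (p * q) + 1)%N \/ (p ^ 2 + 1 = q ^ 2 + 2 * (p * q))%N ->
      (y < 48 ^ 2 * (2 ^ 4) ^ 6)%N.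
    move=> cop ey hpq; have [oq|oq] := boolP (odd q); last first.
      have [m [n [_ e1 e3 ->]]] := pythagorean_parametrization cop oq ey.
      apply: (thue_nat_bound e1 e3); left; clear -hpq.
      by move: (p ^ 2)%N (q ^ 2)%N (p * q)%N hpq => P Q T; lia.
    have op : ~~ odd p.
      apply/negP => op; have : odd (p ^ 2) = odd (q ^ 2 + 2 * (p * q) + 1) \/
        odd (p ^ 2 + 1) = odd (q ^ 2 + 2 * (p * q)).
        by case: hpq => ->; [left|right].
      by rewrite !oddD !oddX !oddM op oq /=; case.
    rewrite coprime_sym in cop; rewrite addnC in ey.
    have [m [n [_ e1 e3 ->]]] := pythagorean_parametrization cop op ey.
    apply: (thue_nat_bound e1 e3); right; clear -hpq; rewrite (mulnC p q) in hpq.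
    by move: (p ^ 2)%N (q ^ 2)%N (q * p)%N hpq => P Q T; lia.
  have [os|os] := boolP (odd s.+1); last first.
    have [p [q [cop e1 e3 e4]]] := pythagorean_parametrization cops os e2.
    by apply: (key p q cop) => //; right; lia.
  rewrite coprime_sym in cops; rewrite addnC in e2.
  have [p [q [cop e1 e3 e4]]] := pythagorean_parametrization cops os e2.
  by apply: (key p q cop) => //; left; lia.
have [k hk] := pell_complete e'.
have [hge _] := pell_ge k; rewrite hk /= in hge.
have k32 : (k < 32)%N by exact: (lt_exp_of_lt_bound hge ylt).
have ek : (pell k).2 = (y ^ 2)%N by rewrite hk.
have [k0|k3] := pell_not_square k32 ek; [left|right]; apply/eqP;
  rewrite -(eqn_exp2r _ _ (isT : 0 < 2)%N) -ek ?k0 ?k3 //.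
Qed.
End Ljunggren.

(** * Units of Z[sqrt 2] *)

Lemma sqr_eq_double_sqr (a b : nat) : (a ^ 2 = 2 * b ^ 2)%N -> b = 0%N.
Proof.
move=> e; case: (posnP b) => // b0; have a0 : (0 < a)%N by nia.
have := congr1 (logn 2) e; rewrite lognX lognM ?expn_gt0 ?b0 // lognX.
by rewrite (_ : logn 2 2 = 1)%N //; lia.
Qed.

Lemma sqr_eq_double_sqrz (a b : int) : a ^+ 2 = 2 * b ^+ 2 -> b = 0.
Proof.
move=> e; suff : `|b|%N = 0%N by lia.
apply: (@sqr_eq_double_sqr `|a|%N); nia.
Qed.

Lemma sqrz_eq (a b : int) : a ^+ 2 = b ^+ 2 -> a = b \/ a = - b.
Proof. by move=> /eqP; rewrite eqf_sqr => /orP[] /eqP; [left|right]. Qed.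

(** The square is that of d = gcd(p, q): v divides the gcd of p^2 and q^2, which is d^2, and d^2
    divides 2 p^2 - q^2 = v or -v. *)
Lemma coprime_part_square (v p q : int) : (2 * p ^+ 2 - q ^+ 2) ^+ 2 = v ^+ 2 ->
  (v %| q ^+ 2)%Z -> (v %| p ^+ 2)%Z -> exists d, `|v|%N = (d ^ 2)%N.
Proof.
move=> e vq vp; pose d := gcdn `|p| `|q|; exists d.
have [d0|d0] := posnP d.
  have : ~~ ((0 < `|p|)%N || (0 < `|q|)%N) by rewrite -gcdn_gt0 -/d d0.
  rewrite negb_or -!leqNgt !leqn0 !absz_eq0 => /andP[/eqP p0 /eqP q0].
  have : v ^+ 2 == 0 by rewrite -e p0 q0.
  by rewrite d0 expf_eq0 /= => /eqP ->.
have [p' ep] : exists p', `|p|%N = (d * p')%N.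
  by have /dvdnP [k ->] := dvdn_gcdl `|p| `|q|; exists k; rewrite mulnC.
have [q' eq] : exists q', `|q|%N = (d * q')%N.
  by have /dvdnP [k ->] := dvdn_gcdr `|p| `|q|; exists k; rewrite mulnC.
have cop : coprime p' q'.
  by rewrite /coprime -(eqn_pmul2l d0) muln1 muln_gcdr -ep -eq.
have vq' : (`|v| %| d ^ 2 * q' ^ 2)%N by rewrite -expnMn -eq -abszX.
have vp' : (`|v| %| d ^ 2 * p' ^ 2)%N by rewrite -expnMn -ep -abszX.
have vd : (`|v| %| d ^ 2)%N.
  have : (`|v| %| gcdn (d ^ 2 * p' ^ 2) (d ^ 2 * q' ^ 2))%N by rewrite dvdn_gcd vp' vq'.
  by rewrite -muln_gcdr (eqP (coprimeXl 2 (coprimeXr 2 cop))) muln1.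
apply/eqP; rewrite eqn_dvd vd /=.
have -> : `|v|%N = absz (2 * p ^+ 2 - q ^+ 2)%R.
  by case: (sqrz_eq e) => ->; rewrite ?abszN.
have sqz (z : int) (k : nat) : `|z|%N = (d * k)%N -> z ^+ 2 = (d ^ 2)%N%:Z * (k ^ 2)%N%:Z.
  by move=> hz; rewrite -PoszM -expnMn -hz -abszX gez0_abs // sqr_ge0.
rewrite (sqz _ _ ep) (sqz _ _ eq) mulrCA -mulrBr abszM; exact: dvdn_mulr.
Qed.

(* (U, V, p, q) stands for x = U + V s and y = p + q s with x y > 0; the order is
   that of the eight triples. *)
Definition unit_solutions : seq (int * int * int * int) :=
  [:: (1, 1, 0, 1); (-1, -1, 0, -1); (-1, 1, 2, -1); (1, -1, -2, 1);
      (239, 169, 130, 91); (-239, -169, -130, -91);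
      (-239, 169, -312, 221); (239, -169, 312, -221)].

(** The last two hypotheses are the coordinates of x^2 + 1 = (2 + s) y^2, which determines y only up
    to sign. *)
Lemma unit_solutionsP (U V p q : int) :
  U ^+ 2 - 2 * V ^+ 2 = 1 \/ U ^+ 2 - 2 * V ^+ 2 = -1 ->
  U ^+ 2 + 2 * V ^+ 2 + 1 = 2 * (p ^+ 2 + 2 * q ^+ 2) + 4 * (p * q) ->
  2 * (U * V) = p ^+ 2 + 2 * q ^+ 2 + 4 * (p * q) ->
  (U, V, p, q) \in unit_solutions \/ (U, V, - p, - q) \in unit_solutions.
Proof.
move=> [n1|nN1] e1 e2.
  (* For norm 1, x^2 + 1 = 2 U x has norm 4 U^2, while 2 + s has norm 2. *)
  have h : (p ^+ 2 - 2 * q ^+ 2) ^+ 2 = 2 * U ^+ 2.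
    have : (U ^+ 2 + 2 * V ^+ 2 + 1) ^+ 2 - 2 * (2 * (U * V)) ^+ 2 = 4 * U ^+ 2.
      by apply: (lincomb (c := (U ^+ 2 - 2 * V ^+ 2 - 1 : int)) n1); ring.
    rewrite e1 e2 => h0; apply: (mulfI (isT : (2 : int) != 0)).
    by apply: (lincomb (c := (1 : int)) h0); ring.
  by have U0 := sqr_eq_double_sqrz h; move: n1; rewrite U0; nia.
have eU : U ^+ 2 = 2 * V ^+ 2 - 1 by lia.
have [P eP] : exists P, p = 2 * P.
  have h : p ^+ 2 = 2 * (V ^+ 2 - q ^+ 2 - p * q) by lia.
  have : (2 %| p ^+ 2)%Z by rewrite h dvdz_mulr.
  rewrite dvdzE abszX Euclid_dvdX // andbT => /dvdnP [k hk].
  by case: (leP 0 p) => hp; [exists k%:Z | exists (- k%:Z)]; lia.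
subst p.
(* For norm -1, x^2 + 1 = 2 V s x; with 2 + s = s (s + 1) this gives y^2 = 2 V (s - 1) x. Its
   coordinates are [f1] and [f2], and its norm gives [f3]. *)
have f1 : V * (U - V) = 2 * (P * q) by nia.
have f2 : V * (2 * V - U) = 2 * P ^+ 2 + q ^+ 2 by nia.
have f3 : (2 * P ^+ 2 - q ^+ 2) ^+ 2 = V ^+ 2.
  have -> : (2 * P ^+ 2 - q ^+ 2) ^+ 2 = (2 * P ^+ 2 + q ^+ 2) ^+ 2 - 2 * (2 * (P * q)) ^+ 2.
    by ring.
  rewrite -f1 -f2; have -> : (V * (2 * V - U)) ^+ 2 - 2 * (V * (U - V)) ^+ 2
    = V ^+ 2 * (2 * V ^+ 2 - U ^+ 2) by ring.
  by rewrite eU; ring.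
have sqN (z : int) : (`|z| ^ 2)%N%:Z = z ^+ 2 by rewrite -abszX gez0_abs // sqr_ge0.
have eUn : (`|U| ^ 2 + 1 = 2 * `|V| ^ 2)%N.
  apply/eqP; rewrite -eqz_nat PoszD PoszM !sqN eU; apply/eqP; ring.
have oV : coprimez V 2.
  rewrite /coprimez /gcdz /= eqz_nat -/(coprime _ _) coprimen2.
  apply: contraT => evV; move: eUn.
  have := odd_double_half `|V|; rewrite (negPf evV) add0n -mul2n => <-.
  have := odd_double_half `|U|; rewrite -mul2n.
  by case: (odd _) => <-; move: (_./2) (_./2) => a b; clear; nia.
have f4 := sqrz_eq f3.
(* Since 2 P^2 - q^2 is V or -V, [f2] makes 2 q^2 and 4 P^2 multiples of V, and V is odd. *)
have dq : (V %| q ^+ 2)%Z.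
  rewrite -(Gauss_dvdzr _ oV); apply/dvdzP.
  by case: f4 => f4; [exists (2 * V - U - 1) | exists (2 * V - U + 1)]; clear -f2 f4; lia.
have dP : (V %| P ^+ 2)%Z.
  rewrite -(Gauss_dvdzr _ oV) -(Gauss_dvdzr _ oV); apply/dvdzP.
  by case: f4 => f4; [exists (2 * V - U + 1) | exists (2 * V - U - 1)]; clear -f2 f4; lia.
have [d hd] := coprime_part_square f3 dq dP.
have lj : (`|U| ^ 2 + 1 = 2 * d ^ 4)%N by rewrite eUn hd -expnM.
clear -f1 f2 f4 hd lj eU.
(* Now V is known up to sign, hence so is U. Then [f2] and [f4] fix P^2, and q follows from [f1], or
   from [f2] when P = 0. *)
have [d1|d13] := ljunggren lj.
  have hV : V = 1 \/ V = -1 by clear -hd d1; rewrite d1 in hd; lia.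
  have U2 : U ^+ 2 = 1 ^+ 2 by rewrite eU; case: hV => ->.
  case: hV (sqrz_eq U2) => ? [] ?; subst U V.
  - have hP : P = 0 by clear -f2 f4; case: f4; nia.
    have hq : q ^+ 2 = 1 ^+ 2 by clear -f2 hP; subst P; lia.
    by case: (sqrz_eq hq) => ?; subst; [left | right].
  - have hP : P ^+ 2 = 1 ^+ 2 by clear -f2 f4; case: f4; lia.
    case: (sqrz_eq hP) => ?; subst P; [left | right].
      by have -> : q = -1 by clear -f1; lia.
    by have -> : q = 1 by clear -f1; lia.
  - have hP : P ^+ 2 = 1 ^+ 2 by clear -f2 f4; case: f4; lia.
    case: (sqrz_eq hP) => ?; subst P; [right | left].
      by have -> : q = -1 by clear -f1; lia.
    by have -> : q = 1 by clear -f1; lia.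
  - have hP : P = 0 by clear -f2 f4; case: f4; nia.
    have hq : q ^+ 2 = 1 ^+ 2 by clear -f2 hP; subst P; lia.
    by case: (sqrz_eq hq) => ?; subst; [right | left].
have hV : V = 169 \/ V = -169 by clear -hd d13; rewrite d13 in hd; lia.
have U2 : U ^+ 2 = 239 ^+ 2 by rewrite eU; case: hV => ->; clear; lia.
case: hV (sqrz_eq U2) => ? [] ?; subst U V.
- have hP : P ^+ 2 = 65 ^+ 2 by clear -f2 f4; case: f4; lia.
  case: (sqrz_eq hP) => ?; subst P; [left | right].
    by have -> : q = 91 by clear -f1; lia.
  by have -> : q = -91 by clear -f1; lia.
- have hP : P ^+ 2 = 156 ^+ 2 by clear -f2 f4; case: f4; lia.
  case: (sqrz_eq hP) => ?; subst P; [right | left].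
    by have -> : q = -221 by clear -f1; lia.
  by have -> : q = 221 by clear -f1; lia.
- have hP : P ^+ 2 = 156 ^+ 2 by clear -f2 f4; case: f4; lia.
  case: (sqrz_eq hP) => ?; subst P; [left | right].
    by have -> : q = -221 by clear -f1; lia.
  by have -> : q = 221 by clear -f1; lia.
- have hP : P ^+ 2 = 65 ^+ 2 by clear -f2 f4; case: f4; lia.
  case: (sqrz_eq hP) => ?; subst P; [right | left].
    by have -> : q = 91 by clear -f1; lia.
  by have -> : q = -91 by clear -f1; lia.
Qed.

(** * Periodic continued fractions of period 3 *)

Section Convergents.
Context {R : realType}.
Local Notation C := R[i].
Implicit Types (c : nat -> C) (z beta : C).

Lemma normcE_real z : `|z| = (normc z)%:C.
Proof. by case: z. Qed.

Lemma cf_matrix_ext c c' n : c =1 c' -> cf_matrix c n = cf_matrix c' n.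
Proof. by move=> e; apply: eq_bigr => k _; rewrite e. Qed.

Lemma cf_matrixS c n :
  cf_matrix c n.+1 0 0 = c 0%N * cf_matrix (c \o succn) n 0 0 + cf_matrix (c \o succn) n 1 0
  /\ cf_matrix c n.+1 1 0 = cf_matrix (c \o succn) n 0 0.
Proof.
have -> : cf_matrix c n.+1 = cf_step (c 0%N) *m cf_matrix (c \o succn) n.
  by rewrite /cf_matrix big_ord_recl.
move: (cf_matrix _ n) => M; rewrite !mxE !big_ord_recl !big_ord0 !mxE /=.
have -> : lift ord0 ord0 = 1 :> 'I_2 by apply/val_inj.
have -> : ord0 = 0 :> 'I_2 by apply/val_inj.
by split; ring.
Qed.

Section Period3.
Variables (a1 a2 a3 : C).
Let c := periodic_quotients (triple a1 a2 a3).
Let p n := cf_matrix c n 0 0.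
Let q n := cf_matrix c n 1 0.

Lemma period3_rec n :
  p n.+3 = (a1 * a2 * a3 + a1 + a3) * p n + (a1 * a2 + 1) * q n /\
  q n.+3 = (a2 * a3 + 1) * p n + a2 * q n.
Proof.
have [e1 e2] := cf_matrixS c n.+2.
have [e3 e4] := cf_matrixS (c \o succn) n.+1.
have [e5 e6] := cf_matrixS (c \o succn \o succn) n.
have ec : c \o succn \o succn \o succn =1 c.
  by move=> k; rewrite /c /periodic_quotients /= -addn3 modnDr.
rewrite /p /q e1 e2 e3 e4 e5 e6 !(cf_matrix_ext _ ec).
by rewrite /c /periodic_quotients /=; split; ring.
Qed.

Lemma period3_init : (p 0 = 1 /\ q 0 = 0) /\ (p 1 = a1 /\ q 1 = 1) /\ (p 2 = a1 * a2 + 1 /\ q 2 = a2).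
Proof.
have e0 c' : cf_matrix c' 0 0 0 = 1 /\ cf_matrix c' 0 1 0 = 0.
  by rewrite /cf_matrix big_ord0 !mxE.
have [h1 h2] := e0 c.
have [e1 e2] := cf_matrixS c 0; have [e3 e4] := cf_matrixS c 1.
have [e5 e6] := cf_matrixS (c \o succn) 0.
have [h3 h4] := e0 (c \o succn); have [h5 h6] := e0 (c \o succn \o succn).
rewrite /p /q h1 h2 e1 e2 e3 e4 e5 e6 h3 h4 h5 h6 /c /periodic_quotients /=.
by do !split; ring.
Qed.

End Period3.

(** Near a finite point the compactification looks like the complex plane, so the convergents are
    eventually finite and converge in the usual sense. *)
Lemma cf_has_valueP c beta : cf_has_value c (Some beta) <->
  forall e : R, 0 < e -> \forall n \near \oo,
    cf_matrix c n 1 0 != 0 /\ normc (beta - cf_matrix c n 0 0 / cf_matrix c n 1 0) < e.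
Proof.
split.
  move=> h e e0.
  have nb : nbhs (Some beta : P1) (Some @` (ball (beta : C^o) e%:C)).
    by apply: one_point_compactification_some_nbhs; apply: nbhsx_ballx; rewrite ltcR.
  have hn : \forall n \near \oo, (Some @` (ball (beta : C^o) e%:C)) (cf_convergent c n).
    exact: h _ nb.
  move: hn; apply: filterS => n /= [w bw].
  rewrite /cf_convergent /P1_ratio; case: ifPn => // q0 [ew]; split => //.
  by move: bw; rewrite -ball_normE /= normcE_real ltcR ew.
move=> h U /= /nbhs_ballP [e /= e0 be].
have er : e = (complex.Re e)%:C by apply/esym/RRe_real; rewrite gtr0_real.
have e0' : 0 < complex.Re e by rewrite -ltcR -er.
have hn := h _ e0'; rewrite /= /nbhs /=; move: hn; apply: filterS => n [q0 hn].
rewrite /cf_convergent /P1_ratio /= (negPf q0); apply: be.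
by rewrite -ball_normE /= normcE_real er ltcR.
Qed.

Section Period3Value.
Variables (a1 a2 a3 : C).
Let c := periodic_quotients (triple a1 a2 a3).
Let p n := cf_matrix c n 0 0.
Let q n := cf_matrix c n 1 0.

(** The convergent at n + 3 is the image of that at n under the Mobius map of the period. Both are
    near beta, so the cross-multiplied fixed point equation holds up to d K for every small d. *)
Lemma period3_value_fixed beta : cf_has_value c (Some beta) ->
  beta * ((a2 * a3 + 1) * beta + a2) = (a1 * a2 * a3 + a1 + a3) * beta + (a1 * a2 + 1).
Proof.
move=> /cf_has_valueP h.
set E1 := LHS; set E2 := RHS.
set m00 := a1 * a2 * a3 + a1 + a3 in E2 *; set m01 := a1 * a2 + 1 in E2 *.
set m10 := a2 * a3 + 1 in E1 *.
pose K := normc (m10 * beta + a2) + (normc beta + 1) * normc m10 + normc m00.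
have K0 : 0 <= K.
  by rewrite !addr_ge0 ?mulr_ge0 ?addr_ge0 ?normc_ge0.
have key (d : R) : 0 < d -> d <= 1 -> normc (E1 - E2) <= d * K.
  move=> d0 d1; have [N _ hN] := h d d0.
  have [q0 z0] := hN N (leqnn _).
  have [q3 z3] := hN N.+3 (leq_trans (leqnSn _) (leq_trans (leqnSn _) (leqnSn _))).
  rewrite -/(q _) -/(p _) in q0 z0 q3 z3.
  have [e1 e2] := period3_rec a1 a2 a3 N.
  rewrite -/c -/(p N) -/(p N.+3) -/(q N) -/(q N.+3) -/m00 -/m01 -/m10 in e1 e2.
  set z := p N / q N in z0; set z' := p N.+3 / q N.+3 in z3.
  have ez : z' * (m10 * z + a2) = m00 * z + m01.
    have q3' : m10 * p N + a2 * q N != 0 by rewrite -e2.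
    rewrite /z' /z e1 e2; move: (p N) (q N) q0 q3' => P Q Q0 Q3.
    by field; rewrite Q0 Q3.
  have -> : E1 - E2 = (beta - z') * (m10 * beta + a2) + z' * m10 * (beta - z)
      - m00 * (beta - z).
    by apply: (lincomb (c := (1 : C)) ez); rewrite /E1 /E2; ring.
  apply: le_trans (normcD_le _ _) _; rewrite normcN /K [d * _]mulrDr.
  apply: lerD; last by rewrite normcM mulrC ler_wpM2r ?normc_ge0 // ltW.
  apply: le_trans (normcD_le _ _) _; rewrite [d * _]mulrDr; apply: lerD.
    by rewrite normcM ler_wpM2r ?normc_ge0 // ltW.
  have hz' : normc z' <= normc beta + 1.
    have -> : z' = beta - (beta - z') by ring.
    apply: le_trans (normcD_le _ _) _; rewrite normcN lerD2l.
    by apply: le_trans (ltW z3) d1.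
  rewrite normcM [leLHS]mulrC normcM.
  apply: ler_pM; [exact: normc_ge0 | | exact: ltW | ].
    by rewrite mulr_ge0 ?normc_ge0.
  by apply: ler_wpM2r; [exact: normc_ge0 | ].
have n0 : normc (E1 - E2) = 0.
  apply/eqP; rewrite eq_le normc_ge0 andbT leNgt; apply/negP => npos.
  set w := normc _ in npos key.
  have k2 : 0 < K + w + 1 by lra.
  have := key (w / (K + w + 1)) (divr_gt0 npos k2).
  rewrite ler_pdivrMr // => /(_ _) -/(_ _); rewrite mul1r.
  have h1 : w <= K + w + 1 by lra.
  move/(_ h1); rewrite mulrAC ler_pdivlMr //; nra.
by apply/eqP; rewrite -subr_eq0; apply/eqP/eq0_normc.
Qed.

Section Eigen.
Variable b : R.
Hypothesis b0 : 0 < b.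
Let beta : C := b%:C.
Let y := a2 * a3 + 1.
Hypothesis h1 : a1 * a2 * a3 + a1 + a3 = a2.
Hypothesis h2 : a1 * a2 + 1 = beta ^+ 2 * y.
(** By [h1] and [h2] the period matrix has rows (a2, beta^2 y) and (y, a2). [S] and [D] are the
    coordinates along its left eigenvectors (1, beta) and (1, -beta), with eigenvalues a2 + beta y
    and a2 - beta y. *)
Let S n := p n + beta * q n.
Let D n := p n - beta * q n.

Lemma period3_S n : S n.+3 = (a2 + beta * y) * S n.
Proof.
have [e1 e2] := period3_rec a1 a2 a3 n.
rewrite -/c -/(p n) -/(p n.+3) -/(q n) -/(q n.+3) in e1 e2.
rewrite /S e1 e2 h1 h2 -/y; ring.
Qed.

Lemma period3_D n : D n.+3 = (a2 - beta * y) * D n.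
Proof.
have [e1 e2] := period3_rec a1 a2 a3 n.
rewrite -/c -/(p n) -/(p n.+3) -/(q n) -/(q n.+3) in e1 e2.
rewrite /D e1 e2 h1 h2 -/y; ring.
Qed.

(** Otherwise [S] stays dominated by [D] along multiples of 3, starting from S = D = 1, so these
    convergents are never closer to beta than to -beta. *)
Lemma period3_value_sign : cf_has_value c (Some beta) ->
  normc (a2 - beta * y) < normc (a2 + beta * y).
Proof.
move=> /cf_has_valueP h; rewrite ltNge; apply/negP => hle.
have hSD k : normc (S (3 * k)) <= normc (D (3 * k)).
  have [[p0 q0] _] := period3_init a1 a2 a3; rewrite -/c in p0 q0.
  elim: k => [|k IH]; first by rewrite /S /D /p /q muln0 p0 q0 mulr0 addr0 subr0.
  have -> : (3 * k.+1 = (3 * k).+3)%N by clear; lia.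
  by rewrite period3_S period3_D !normcM ler_pM ?normc_ge0.
have [N _ hN] := h b b0.
have [qN zN] := hN (3 * N)%N (leq_pmull N (isT : 0 < 3)%N).
rewrite -/(p _) -/(q _) in qN zN.
have := hSD N; set n := (3 * N)%N in qN zN *.
have -> : S n = (2 * beta - (beta - p n / q n)) * q n by rewrite /S; field.
have -> : D n = - (beta - p n / q n) * q n by rewrite /D; field.
have qp : 0 < normc (q n).
  by rewrite lt_def normc_ge0 andbT; apply: contraNneq qN => /eq0_normc ->.
rewrite !normcM ler_pM2r // normcN; set w := beta - _ in zN *.
have : 2 * b <= normc (2 * beta - w) + normc w.
  have -> : 2 * b = normc (2 * beta).
    by rewrite normcM normc_nat normc_real gtr0_norm.
  have -> : 2 * beta = (2 * beta - w) + w by ring.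
  by rewrite addrK; exact: normcD_le.
lra.
Qed.

(** The ratio r = D / S tends to 0 geometrically in each residue class modulo 3, and beta - p / q =
    - 2 beta r / (1 - r). *)
Lemma period3_value_of_sign : a1 + beta != 0 ->
  normc (a2 - beta * y) < normc (a2 + beta * y) -> cf_has_value c (Some beta).
Proof.
move=> a1b hlt; apply/cf_has_valueP => e e0.
set l := a2 + beta * y in hlt *; set m := a2 - beta * y in hlt.
have lp : 0 < normc l by apply: le_lt_trans hlt; exact: normc_ge0.
have l0 : l != 0 by apply/eqP => l0; move: lp; rewrite l0 normc0 ltxx.
have bC : beta != 0 by rewrite fmorph_eq0 gt_eqF.
have [[p0 q0] [[p1 q1] [p2 q2]]] := period3_init a1 a2 a3.
rewrite -/c -/(p 0) -/(q 0) -/(p 1) -/(q 1) -/(p 2) -/(q 2) in p0 q0 p1 q1 p2 q2.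
(* The starting values are 1, a1 + beta and beta l. *)
have S0 k j : (j < 3)%N -> S (3 * k + j) != 0.
  move=> j3; elim: k => [|k IH].
    rewrite muln0 add0n; case: j j3 => [|[|[|//]]] _.
    - by rewrite /S p0 q0 mulr0 addr0 oner_eq0.
    - by rewrite /S p1 q1 mulr1.
    - rewrite /S p2 q2 h2 (_ : _ + _ = beta * l) ?mulf_neq0 // /l; ring.
  have -> : (3 * k.+1 + j = (3 * k + j).+3)%N by clear; lia.
  by rewrite period3_S mulf_neq0.
pose K := normc (D 0 / S 0) + normc (D 1 / S 1) + normc (D 2 / S 2).
pose kap := normc m / normc l.
have kap0 : 0 <= kap by rewrite divr_ge0 ?normc_ge0.
have kap1 : kap < 1 by rewrite ltr_pdivrMr // mul1r.
have K0 : 0 <= K by rewrite !addr_ge0 ?normc_ge0.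
have rho k j : (j < 3)%N -> normc (D (3 * k + j) / S (3 * k + j)) <= K * kap ^+ k.
  move=> j3; elim: k => [|k IH].
    rewrite muln0 add0n expr0 mulr1 /K.
    have n0 := normc_ge0 (D 0 / S 0); have n1 := normc_ge0 (D 1 / S 1).
    have n2 := normc_ge0 (D 2 / S 2).
    by case: j j3 => [|[|[|//]]] _; lra.
  have -> : (3 * k.+1 + j = (3 * k + j).+3)%N by clear; lia.
  rewrite period3_S period3_D -/l -/m invfM mulrACA normcM exprS mulrCA.
  by rewrite ler_pM ?normc_ge0 // normcM normcV.
(* From |r| < d <= 1/2 follows |1 - r| >= 1/2, so the error is below 4 b d. *)
have [d [d0 d2 de]] : exists d : R, [/\ 0 < d, d <= 2^-1 & 4 * b * d < e].
  exists (Num.min 2^-1 (e / (8 * b))); split.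
  - by rewrite lt_min divr_gt0 ?mulr_gt0 // invr_gt0 ltr0n.
  - by rewrite ge_min lexx.
  have : Num.min 2^-1 (e / (8 * b)) <= e / (8 * b) by rewrite ge_min lexx orbT.
  rewrite ler_pdivlMr ?mulr_gt0 //; move: (Num.min _ _) => d hd; nra.
have hk : kap ^+ n @[n --> \oo] --> (0 : R).
  by apply: cvg_expr; rewrite ger0_norm.
have d0' : 0 < d / (K + 1) by rewrite divr_gt0 // ltr_wpDl.
move/cvgrPdist_lt/(_ _ d0') : hk => [N _ hN].
exists (3 * N)%N => // n /= nN.
pose k := (n %/ 3)%N; pose j := (n %% 3)%N.
have en : n = (3 * k + j)%N by rewrite mulnC -divn_eq.
have j3 : (j < 3)%N by rewrite ltn_mod.
have kN : (N <= k)%N by rewrite /k leq_divRL // mulnC.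
have rn : normc (D n / S n) < d.
  rewrite {1 2}en (le_lt_trans (rho _ _ j3)) //.
  have := hN k kN; rewrite /= sub0r normrN ger0_norm ?exprn_ge0 //.
  rewrite ltr_pdivlMr ?ltr_wpDl // => hd; have := exprn_ge0 k kap0; nra.
have Sn : S n != 0 by rewrite en S0.
set r := D n / S n in rn.
have eD : D n = r * S n by rewrite /r divfK.
clearbody r.
have rl : 1 - normc r <= normc (1 - r).
  have := normcD_le (1 - r) r; by rewrite subrK normc1 lerBlDr addrC [normc r + _]addrC.
have r1 : 1 - r != 0 by apply/eqP => hr; move: rl; rewrite hr normc0; lra.
have eq2 : 2 * beta * q n = S n * (1 - r).
  by rewrite mulrBr mulr1 [S n * r]mulrC -eD /S /D; ring.
have n2 : (2 : C) != 0 by rewrite pnatr_eq0.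
have qn : q n != 0.
  apply/eqP => q00; have := mulf_neq0 Sn r1; rewrite -eq2 q00 mulr0; by rewrite eqxx.
rewrite -/(p n) -/(q n); split => //.
have -> : beta - p n / q n = - (2 * beta * r / (1 - r)).
  apply: (mulIf qn); apply: (mulIf r1).
  have -> : (beta - p n / q n) * q n * (1 - r) = - D n * (1 - r) by rewrite /D; field.
  have -> : - (2 * beta * r / (1 - r)) * q n * (1 - r) = - r * (2 * beta * q n).
    by field.
  by rewrite eq2 eD; ring.
rewrite normcN normcM normcV // !normcM normc_nat normc_real gtr0_norm //.
have r1p : 0 < normc (1 - r) by lra.
rewrite ltr_pdivrMr //; have r0 := normc_ge0 r; clear -b0 e0 d0 d2 de rn rl r0.
move: (normc r) (normc (1 - r)) r0 rn rl => x z x0 xd xz.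
have z2 : 2^-1 <= z by lra.
have : e * 2^-1 <= e * z by rewrite ler_wpM2l // ltW.
have : b * x <= b * d by rewrite ler_wpM2l // ltW.
lra.
Qed.
End Eigen.

End Period3Value.
End Convergents.

(** * Classification *)

Section Sqrt2.
Context {R : realType}.
Local Notation C := R[i].
Local Notation r2 := (Num.sqrt (2 : R)).
Local Notation s := (@sqrt2 R).
Local Notation br := (Num.sqrt (2 + r2)).
Local Notation beta := (br%:C).

Definition zr (u v : int) : R := u%:~R + v%:~R * r2.
Definition zs (u v : int) : C := u%:~R + v%:~R * s.

Lemma sqr_r2 : r2 ^+ 2 = 2.
Proof. by rewrite sqr_sqrtr. Qed.

Lemma sqr_s : s ^+ 2 = 2.
Proof. by rewrite /sqrt2 -rmorphXn sqr_r2 rmorph_nat. Qed.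

Lemma zsE u v : zs u v = (zr u v)%:C.
Proof. by rewrite /zs /zr /sqrt2 rmorphD rmorphM !rmorph_int. Qed.

Lemma zsM u v u' v' : zs u v * zs u' v' = zs (u * u' + 2 * v * v') (u * v' + v * u').
Proof. by apply: (lincomb (c := (v%:~R * v'%:~R : C)) sqr_s); rewrite /zs; ring. Qed.

Lemma zr_eq0 u v : zr u v = 0 -> u = 0 /\ v = 0.
Proof.
rewrite /zr => h; have e : u ^+ 2 = 2 * v ^+ 2.
  apply: (@intr_inj R); rewrite rmorphXn rmorphM rmorphXn /=.
  have -> : u%:~R = - (v%:~R * r2) by apply/eqP; rewrite -addr_eq0 h.
  by rewrite sqrrN exprMn sqr_r2 mulrC.
have v0 := sqr_eq_double_sqrz e; split => //.
by move: h; rewrite v0 mul0r addr0 => /eqP; rewrite intr_eq0 => /eqP.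
Qed.

Lemma zs_inj u v u' v' : zs u v = zs u' v' -> u = u' /\ v = v'.
Proof.
rewrite !zsE => /complexI; rewrite /zr => h.
have [] := @zr_eq0 (u - u') (v - v'); last by move=> /eqP + /eqP; rewrite !subr_eq0 => /eqP + /eqP.
by apply: (lincomb (c := (1 : R)) h); rewrite /zr; ring.
Qed.

Lemma Zsqrt2P (z : C) : Zsqrt2 z <-> exists u v, z = zs u v.
Proof. by []. Qed.

Lemma Zsqrt2_zs u v : Zsqrt2 (zs u v).
Proof. by exists u, v. Qed.

Lemma Zsqrt2D (z w : C) : Zsqrt2 z -> Zsqrt2 w -> Zsqrt2 (z + w).
Proof. by move=> [a [b ->]] [c [d ->]]; exists (a + c), (b + d); ring. Qed.

Lemma Zsqrt2B (z w : C) : Zsqrt2 z -> Zsqrt2 w -> Zsqrt2 (z - w).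
Proof. by move=> [a [b ->]] [c [d ->]]; exists (a - c), (b - d); ring. Qed.

Lemma Zsqrt2M (z w : C) : Zsqrt2 z -> Zsqrt2 w -> Zsqrt2 (z * w).
Proof.
by move=> /Zsqrt2P[a [b ->]] /Zsqrt2P[c [d ->]]; rewrite zsM; exact: Zsqrt2_zs.
Qed.

Lemma Zsqrt21 : Zsqrt2 (1 : C).
Proof. by exists 1, 0; ring. Qed.

Lemma r2_ge0 : 0 <= r2.
Proof. exact: sqrtr_ge0. Qed.

Lemma br_gt0 : 0 < br.
Proof. by rewrite sqrtr_gt0; have := r2_ge0; lra. Qed.

Lemma sqr_beta : beta ^+ 2 = 2 + s.
Proof.
rewrite -rmorphXn sqr_sqrtr; last by have := r2_ge0; lra.
by rewrite rmorphD rmorph_nat.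
Qed.

Lemma zs_double u v : (2 + s) * zs u v = zs (2 * u + 2 * v) (u + 2 * v).
Proof. by apply: (lincomb (c := (v%:~R : C)) sqr_s); rewrite /zs; ring. Qed.

(** Taking norms in z^2 = (2 + s) w^2 gives N(z)^2 = 2 N(w)^2, hence N(w) = 0 and w = 0. *)
Lemma beta_irrational (z w : C) : Zsqrt2 z -> Zsqrt2 w -> z + w * beta = 0 -> z = 0 /\ w = 0.
Proof.
move=> /Zsqrt2P[a [b ez]] /Zsqrt2P[c [d ew]] h.
have h2 : z ^+ 2 = (2 + s) * w ^+ 2.
  have -> : z = - (w * beta) by apply/eqP; rewrite -addr_eq0 h.
  by rewrite sqrrN exprMn sqr_beta mulrC.
rewrite !expr2 ez ew !zsM zs_double in h2; have [e1 e2] := zs_inj h2.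
have e3 : (a ^+ 2 - 2 * b ^+ 2) ^+ 2 = 2 * (c ^+ 2 - 2 * d ^+ 2) ^+ 2.
  have : (a * a + 2 * b * b) ^+ 2 - 2 * (a * b + b * a) ^+ 2 = (a ^+ 2 - 2 * b ^+ 2) ^+ 2 by ring.
  by rewrite e1 e2 => <-; ring.
have e4 : c ^+ 2 = 2 * d ^+ 2.
  by apply/eqP; rewrite -subr_eq0; apply/eqP; exact: sqr_eq_double_sqrz e3.
have d0 := sqr_eq_double_sqrz e4.
have c0 : c = 0.
  have : c ^+ 2 == 0 by rewrite e4 d0.
  by rewrite expf_eq0 /= => /eqP.
have w0 : w = 0 by rewrite ew d0 c0 /zs; ring.
split; last exact: w0.
have : z + w * beta = z by rewrite w0 mul0r addr0.
by rewrite h => <-.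
Qed.

(** These two rational bounds decide the signs of all entries of [unit_solutions]. *)
Lemma r2_bounds : 239 < 169 * r2 /\ 2 * r2 < 3.
Proof.
have h := sqr_r2; have h0 := r2_ge0.
by split; rewrite ltNge; apply/negP => hle; nra.
Qed.

Lemma unit_solutions_pos U V p q : (U, V, p, q) \in unit_solutions ->
  0 < zr U V * zr p q.
Proof.
have [h1 h2] := r2_bounds.
have pp (x y : R) : 0 < x -> 0 < y -> 0 < x * y by exact: mulr_gt0.
have nn (x y : R) : x < 0 -> y < 0 -> 0 < x * y by move=> ? ?; rewrite nmulr_rgt0.
rewrite !inE => /orP[|/orP[|/orP[|/orP[|/orP[|/orP[|/orP[|]]]]]]] /eqP[-> -> -> ->];
  rewrite /zr; first [apply: pp; lra | apply: nn; lra].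
Qed.

Definition pcf_triples : seq (3.-tuple C) := [::
    triple (3 - s) (1 + s) (3 - 2 * s);
    triple (1 + s) (- 1 - s) 1;
    triple (1 + s) (- 1 + s) (- 1);
    triple (3 + 3 * s) (1 - s) (1 + 2 * s);
    triple (57 - 39 * s) (239 + 169 * s) (- 73 + 52 * s);
    triple (- 421 + 299 * s) (- 239 - 169 * s) (- 551 + 390 * s);
    triple (203 + 143 * s) (- 239 + 169 * s) (- 109 - 78 * s);
    triple (681 + 481 * s) (239 - 169 * s) (369 + 260 * s)].

(** Indices start at 0, so this says a2 = x, a2 a3 + 1 = y and a1 a2 + 1 = beta^2 y. As x is
    nonzero, it determines the triple. *)
Definition solves (a : 3.-tuple C) (w : int * int * int * int) : Prop :=
  let: (U, V, p, q) := w in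
  [/\ a`_1 = zs U V, a`_1 * a`_2 + 1 = zs p q & a`_0 * a`_1 + 1 = (2 + s) * zs p q].

Lemma pcf_triples_solve i : (i < 8)%N ->
  solves (nth (triple 0 0 0) pcf_triples i) (nth (0, 0, 0, 0) unit_solutions i).
Proof.
have hs := sqr_s.
case: i => [|[|[|[|[|[|[|[|//]]]]]]]] _; rewrite /solves /= /zs; split; try ring.
(* Each cofactor is the coefficient of s^2 in the difference of the two sides. *)
- by apply: (lincomb (c := (1 * (- 2) : C)) hs); ring.
- by apply: (lincomb (c := ((- 1) * 1 - 1 : C)) hs); ring.
- by apply: (lincomb (c := (1 * 1 - (- 1) : C)) hs); ring.
- by apply: (lincomb (c := ((- 1) * 2 : C)) hs); ring.
- by apply: (lincomb (c := (3 * (- 1) - 1 : C)) hs); ring.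
- by apply: (lincomb (c := (169 * 52 : C)) hs); ring.
- by apply: (lincomb (c := ((- 39) * 169 - 91 : C)) hs); ring.
- by apply: (lincomb (c := ((- 169) * 390 : C)) hs); ring.
- by apply: (lincomb (c := (299 * (- 169) - (- 91) : C)) hs); ring.
- by apply: (lincomb (c := (169 * (- 78) : C)) hs); ring.
- by apply: (lincomb (c := (143 * 169 - 221 : C)) hs); ring.
- by apply: (lincomb (c := ((- 169) * 260 : C)) hs); ring.
- by apply: (lincomb (c := (481 * (- 169) - (- 221) : C)) hs); ring.
Qed.
End Sqrt2.

Lemma card_eq_uniq_seq (T : choiceType) (l : seq T) :
  uniq l -> ([set` l] #= `I_(size l))%card.
Proof.
move=> ul; have hl x : (x \in [fset y in l]%fset) = (x \in l) by rewrite !inE.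
have -> : [set` l] = [set` [fset y in l]%fset].
  by apply/seteqP; split=> x; rewrite /= hl.
by apply/card_eq_fsetP; rewrite card_fseq undup_id.
Qed.

(** * The PCFs of beta and the eight triples *)

Section Classification.
Context {R : realType}.
Local Notation C := R[i].
Local Notation r2 := (Num.sqrt (2 : R)).
Local Notation s := (@sqrt2 R).
Local Notation br := (Num.sqrt (2 + r2)).
Local Notation beta := (br%:C : C).

Lemma normc_conj_lt U V p q :
  normc (zs U V - beta * zs p q) < normc (zs U V + beta * zs p q)
  <-> 0 < @zr R U V * zr p q.
Proof.
rewrite !zsE -rmorphM -rmorphB -rmorphD !normc_real /=.
set x := zr U V; set y := zr p q; have b0 := @br_gt0 R; set b := br in b0 *.
have e : `|x + b * y| ^+ 2 - `|x - b * y| ^+ 2 = 4 * b * (x * y).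
  by rewrite !real_normK ?num_real //; ring.
rewrite -(ltr_pXn2r (isT : 0 < 2)%N) ?nnegrE ?normr_ge0 // -subr_gt0 e; split=> h.
  by move: h; rewrite pmulr_rgt0 // mulr_gt0.
by rewrite pmulr_rgt0 // mulr_gt0.
Qed.

Lemma triple_eta (a : 3.-tuple C) : a = triple a`_0 a`_1 a`_2.
Proof. by apply/val_inj; case: a => -[|x [|y [|z []]]]. Qed.

Lemma tnth_Zsqrt2 (a : 3.-tuple C) : (forall i, Zsqrt2 (tnth a i)) <->
  [/\ Zsqrt2 a`_0, Zsqrt2 a`_1 & Zsqrt2 a`_2].
Proof.
split=> [h|[h0 h1 h2] i]; last first.
  by rewrite (tnth_nth 0); case: i => -[|[|[|]]].
have h' k : (k < 3)%N -> Zsqrt2 a`_k.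
  by move=> k3; have := h (Ordinal k3); rewrite (tnth_nth 0).
by split; apply: h'.
Qed.

Lemma solves_inj (a a' : 3.-tuple C) w : w \in unit_solutions ->
  solves a w -> solves a' w -> a = a'.
Proof.
case: w => -[[U V] p] q hw [e1 e2 e3] [e1' e2' e3'].
have n0 : zs U V != 0 :> C.
  have := @unit_solutions_pos R _ _ _ _ hw; apply: contraTneq.
  by rewrite zsE => /complexI ->; rewrite mul0r ltxx.
have h2 : a`_2 = a'`_2.
  by apply: (mulfI n0); apply: (addIr 1); rewrite -{1}e1 e2 -e1' e2'.
have h0 : a`_0 = a'`_0.
  by apply: (mulIf n0); apply: (addIr 1); rewrite -{1}e1 e3 -e1' e3'.
by rewrite (triple_eta a) (triple_eta a') h0 h2 e1 e1'.
Qed.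

Lemma unit_solutions_norm U V p q : (U, V, p, q) \in unit_solutions ->
  zs U V ^+ 2 + 1 = (2 + s) * zs p q ^+ 2 :> C.
Proof.
move=> hw; rewrite !expr2 !zsM zs_double.
have [e1 e2] : U * U + 2 * V * V + 1 = 2 * (p * p + 2 * q * q) + 2 * (p * q + q * p) /\
    U * V + V * U = p * p + 2 * q * q + 2 * (p * q + q * p).
  move: hw; rewrite !inE.
  by move=> /orP[|/orP[|/orP[|/orP[|/orP[|/orP[|/orP[|]]]]]]] /eqP[-> -> -> ->]; split; lia.
by rewrite -e1 -e2 /zs; ring.
Qed.

Lemma solves_PCF (a : 3.-tuple C) w : w \in unit_solutions ->
  Zsqrt2 a`_0 -> Zsqrt2 a`_2 -> solves a w -> Zsqrt2_PCF beta a.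
Proof.
case: w => -[[U V] p] q hw h0 h2 [e1 e2 e3].
have hpos := @unit_solutions_pos R _ _ _ _ hw.
have n0 : zs U V != 0 :> C.
  by apply: contraTneq hpos; rewrite zsE => /complexI ->; rewrite mul0r ltxx.
split.
  by apply/tnth_Zsqrt2; split => //; rewrite e1; exact: Zsqrt2_zs.
rewrite (triple_eta a); apply: period3_value_of_sign; first exact: br_gt0.
(* Multiplied by a2, the equality of the diagonal entries becomes the norm equation x^2 + 1 = (2 +
   s) y^2. *)
- apply: (mulIf n0); rewrite -e1.
  have -> : (a`_0 * a`_1 * a`_2 + a`_0 + a`_2) * a`_1
    = (a`_0 * a`_1 + 1) * (a`_1 * a`_2 + 1) - 1 by ring.
  rewrite e2 e3; have := unit_solutions_norm hw; rewrite -e1 => h.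
  by apply: (lincomb (c := (- 1 : C)) h); ring.
- by rewrite e2 e3 sqr_beta.
- apply/eqP => h.
  have [_ /eqP] := beta_irrational h0 Zsqrt21 (etrans (congr1 (fun t => _ + t) (mul1r _)) h).
  by rewrite oner_eq0.
- by rewrite e2 e1; apply/normc_conj_lt.
Qed.

Lemma PCF_solves (a : 3.-tuple C) : Zsqrt2_PCF beta a ->
  exists2 w, w \in unit_solutions & solves a w.
Proof.
move=> [/tnth_Zsqrt2 [z0 z1 z2]]; rewrite {1}(triple_eta a) => hv.
have := period3_value_fixed hv; set a1 := a`_0 in z0 hv *; set a2 := a`_1 in z1 hv *.
set a3 := a`_2 in z2 hv *.
set m00 := a1 * a2 * a3 + a1 + a3; set m01 := a1 * a2 + 1; set y := a2 * a3 + 1 => fix_eq.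
have zy : Zsqrt2 y by apply: Zsqrt2D; [exact: Zsqrt2M | exact: Zsqrt21].
have zm01 : Zsqrt2 m01 by apply: Zsqrt2D; [exact: Zsqrt2M | exact: Zsqrt21].
have zm00 : Zsqrt2 m00.
  by apply: Zsqrt2D => //; apply: Zsqrt2D => //; do !apply: Zsqrt2M.
have zt : Zsqrt2 (2 + s : C) by exists 2, 1; ring.
have hb := @sqr_beta R.
(* The fixed point equation is linear in beta over Z[s] once beta^2 is replaced by 2 + s, so both
   coefficients vanish. *)
have [h2 h1] : m01 - (2 + s) * y = 0 /\ m00 - a2 = 0.
  apply: beta_irrational; [by apply: Zsqrt2B => //; exact: Zsqrt2M | exact: Zsqrt2B | ].
  apply: (lincomb2 (c := (- 1 : C)) (d := (y : C)) fix_eq hb); ring.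
have {}h1 : m00 = a2 by apply/eqP; rewrite -subr_eq0 h1.
have {}h2 : m01 = (2 + s) * y by apply/eqP; rewrite -subr_eq0 h2.
have hs : normc (a2 - beta * y) < normc (a2 + beta * y).
  by apply: period3_value_sign hv; rewrite ?br_gt0 // hb.
have hdet : a2 ^+ 2 + 1 = (2 + s) * y ^+ 2.
  apply: (lincomb2 (c := (- a2 : C)) (d := (y : C)) h1 h2); rewrite /m00 /m01 /y; ring.
have hunit : a2 * (a1 - (2 + s) * a3) = 1 + s.
  by apply: (lincomb (c := (1 : C)) h2); rewrite /m01 /y; ring.
have [u [v euv]] : exists u v, a1 - (2 + s) * a3 = zs u v.
  by apply/Zsqrt2P/Zsqrt2B => //; exact: Zsqrt2M.
have /Zsqrt2P [U [V eUV]] := z1; have /Zsqrt2P [p [q epq]] := zy.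
have [f1 f2] : U * u + 2 * V * v = 1 /\ U * v + V * u = 1.
  by apply: (@zs_inj R); rewrite -zsM -eUV -euv hunit /zs; ring.
(* The norm of [hunit]: 1 + s has norm -1. *)
have hn : (U ^+ 2 - 2 * V ^+ 2) * (u ^+ 2 - 2 * v ^+ 2) = -1.
  have -> : (U ^+ 2 - 2 * V ^+ 2) * (u ^+ 2 - 2 * v ^+ 2)
    = (U * u + 2 * V * v) ^+ 2 - 2 * (U * v + V * u) ^+ 2 by ring.
  by rewrite f1 f2.
have hN : U ^+ 2 - 2 * V ^+ 2 = 1 \/ U ^+ 2 - 2 * V ^+ 2 = -1.
  have /eqP := congr1 absz hn; rewrite abszM muln_eq1 => /andP[/eqP hA _].
  by move: (U ^+ 2 - 2 * V ^+ 2) hA => A hA; clear -hA; lia.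
have [g1 g2] : U * U + 2 * V * V + 1 = 2 * (p * p + 2 * q * q) + 2 * (p * q + q * p) /\
    U * V + V * U = p * p + 2 * q * q + 2 * (p * q + q * p).
  have hz : zs U V * zs U V + 1 = (2 + s) * (zs p q * zs p q).
    by rewrite -eUV -epq -!expr2 hdet.
  by apply: (@zs_inj R); rewrite !zsM zs_double in hz; rewrite -hz /zs; ring.
have solv : solves a (U, V, p, q) by split; rewrite -/a1 -/a2 -/a3 // -/y -/m01 ?epq // h2 epq.
move: hs; rewrite eUV epq => /normc_conj_lt hpos.
have [] := @unit_solutionsP U V p q hN _ _; [by clear -g1; lia | by clear -g2; lia | |].
  by exists (U, V, p, q).
(* The solution with y replaced by -y has x y < 0 and is excluded by the attracting condition. *)
move/(@unit_solutions_pos R); have -> : zr (- p) (- q) = - zr p q :> R by rewrite /zr; ring.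
by rewrite mulrN oppr_gt0 ltNge (ltW hpos).
Qed.

Lemma pcf_triples_Zsqrt2 i : (i < 8)%N ->
  Zsqrt2 (nth (triple 0 0 0) (@pcf_triples R) i)`_0 /\
  Zsqrt2 (nth (triple 0 0 0) (@pcf_triples R) i)`_2.
Proof.
case: i => [|[|[|[|[|[|[|[|//]]]]]]]] _ /=.
- by split; [exists 3, (- 1) | exists 3, (- 2)]; rewrite /=; ring.
- by split; [exists 1, 1 | exists 1, 0]; rewrite /=; ring.
- by split; [exists 1, 1 | exists (- 1), 0]; rewrite /=; ring.
- by split; [exists 3, 3 | exists 1, 2]; rewrite /=; ring.
- by split; [exists 57, (- 39) | exists (- 73), 52]; rewrite /=; ring.
- by split; [exists (- 421), 299 | exists (- 551), 390]; rewrite /=; ring.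
- by split; [exists 203, 143 | exists (- 109), (- 78)]; rewrite /=; ring.
- by split; [exists 681, 481 | exists 369, 260]; rewrite /=; ring.
Qed.

(** The middle entries U + V s are already pairwise distinct. *)
Lemma uniq_pcf_triples : uniq (@pcf_triples R).
Proof.
apply: (@map_uniq _ _ (fun a : 3.-tuple C => a`_1)).
have -> : [seq a`_1 | a : 3.-tuple C <- pcf_triples]
    = [seq zs x.1 x.2 | x <- [seq w.1.1 | w <- unit_solutions]].
  rewrite -map_comp; apply: (@eq_from_nth _ 0); rewrite !size_map // => i i8.
  rewrite (nth_map (triple 0 0 0)) // (nth_map (0, 0, 0, 0)) //.
  have := pcf_triples_solve (R := R) i8; rewrite /solves /=.
  by case: (nth (0, 0, 0, 0) unit_solutions i) => -[[U V] p] q [].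
by rewrite map_inj_uniq // => -[u v] [u' v'] /= /zs_inj [-> ->].
Qed.

End Classification.

Theorem corollary6p8 (R : realType) :
  let s : R[i] := sqrt2 in
  let beta : R[i] := (Num.sqrt (2 + Num.sqrt (2 : R)))%:C in
  let PCFs : set (3.-tuple R[i]) := [set a | Zsqrt2_PCF beta a] in
  (PCFs #= `I_8)%card /\
  PCFs = [set` [::
    triple (3 - s) (1 + s) (3 - 2 * s);
    triple (1 + s) (- 1 - s) 1;
    triple (1 + s) (- 1 + s) (- 1);
    triple (3 + 3 * s) (1 - s) (1 + 2 * s);
    triple (57 - 39 * s) (239 + 169 * s) (- 73 + 52 * s);
    triple (- 421 + 299 * s) (- 239 - 169 * s) (- 551 + 390 * s);
    triple (203 + 143 * s) (- 239 + 169 * s) (- 109 - 78 * s);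
    triple (681 + 481 * s) (239 - 169 * s) (369 + 260 * s)]].
Proof.
move=> s beta PCFs; rewrite -/(@pcf_triples R).
have ePCF : PCFs = [set` @pcf_triples R].
  apply/seteqP; split => a /=.
    (* The lists [unit_solutions] and [pcf_triples] are parallel, so the triple at the index of [w]
       solves the same equations and must be [a]. *)
    move=> /PCF_solves [w hw sw]; have iw : (index w unit_solutions < 8)%N by rewrite index_mem.
    have := pcf_triples_solve (R := R) iw; rewrite nth_index // => sw'.
    by rewrite (solves_inj hw sw sw'); apply: mem_nth.
  move=> ha; have ia : (index a (@pcf_triples R) < 8)%N by rewrite index_mem.
  have := pcf_triples_solve (R := R) ia; rewrite (nth_index (triple 0 0 0) ha) => sa.
  have := pcf_triples_Zsqrt2 (R := R) ia; rewrite (nth_index (triple 0 0 0) ha) => -[z0 z2].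
  apply: solves_PCF sa => //; exact: mem_nth.
split=> //; rewrite ePCF.
exact/card_eq_uniq_seq/uniq_pcf_triples.
Qed.
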